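(* Let $\varepsilon$ be a finite soft excursion. Then the slot diagram $x^{\diamond}[\varepsilon]$ of the Head-Tail (HT) soliton decomposition of $\varepsilon$ and the slot diagram $x^*[\varepsilon]$ of the planar tree associated to $\varepsilon$ coincide: $x^{\diamond}[\varepsilon]=x^*[\varepsilon]$.
   Context: **Excursions.** A finite soft excursion of length $2n$ ($n\ge 0$) is a sequence $\varepsilon=(\varepsilon(0),\dots,\varepsilon(2n))$ of nonnegative integers with $\varepsilon(0)=\varepsilon(2n)=0$ and $|\varepsilon(i)-\varepsilon(i-1)|=1$ for $1\le i\le 2n$. Its ball configuration is $\eta\in\{0,1\}^{\mathbb Z}$ with $2\eta(i)-1=\varepsilon(i)-\varepsilon(i-1)$ for $1\le i\le 2n$ and $\eta(i)=0$ for all other $i$. Elements of $\mathbb Z$ are called boxes; box $i$ is occupied if $\eta(i)=1$ and empty if $\eta(i)=0$. Box $0$ is the record preceding the excursion and box $2n+1$ is the next record. **HT decomposition.** A run is a maximal interval of consecutive boxes with the same value of $\eta$ (a zero-run or a one-run); its size is its number of boxes (possibly $+\infty$). After some boxes have been deleted, runs are computed on the remaining boxes in their inherited order. Repeat the following until only one infinite run remains: take the leftmost among the runs of smallest size; let $k$ be its size. If it is a one-run, pair its boxes with the first (leftmost) $k$ boxes of the neighboring zero-run to its right. If it is a zero-run, pair its boxes with the nearest (rightmost) $k$ boxes of the neighboring one-run to its left. The $2k$ boxes form a $k$-soliton$^\diamond$ $\gamma^\diamond$, with occupied boxes $\mathtt h_1(\gamma^\diamond)<\dots<\mathtt h_k(\gamma^\diamond)$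 and empty boxes $\mathtt t_1(\gamma^\diamond)<\dots<\mathtt t_k(\gamma^\diamond)$. Delete these boxes, update the runs and repeat. **Slot diagram $x^\diamond[\varepsilon]$.** The $k$-slots$^\diamond$ of the excursion are box $0$ and all boxes of the form $\mathtt h_\ell(\gamma^\diamond)$ or $\mathtt t_{m-\ell+1}(\gamma^\diamond)$ with $\ell\in\{1,\dots,m-k\}$, where $\gamma^\diamond$ is an $m$-soliton$^\diamond$ with $m>k$. They are enumerated from left to right starting with number $0$ for box $0$; their number is $s_k^\diamond=1+\sum_{\ell>k}2(\ell-k)n_\ell^\diamond$, with $n_\ell^\diamond$ the number of $\ell$-solitons$^\diamond$. The slot after the last one is understood to be the next record, box $2n+1$. A $k$-soliton$^\diamond$ is attached to $k$-slot$^\diamond$ number $i$ if all its boxes lie strictly between $k$-slots$^\diamond$ number $i$ and $i+1$; $x^\diamond_k(i)$ is the number of $k$-solitons$^\diamond$ attached to $k$-slot$^\diamond$ number $i$, $0\le i<s_k^\diamond$. With $M$ the largest soliton$^\diamond$ size ($M=0$ for the empty excursion), $x^\diamond[\varepsilon]=(x^\diamond_k:1\le k\le M)$, $x_k^\diamond=(x^\diamond_k(0),\dots,x^\diamond_k(s^\diamond_k-1))$. **Tree of an excursion.** Regarding occupied boxes in $[1,2n]$ as open parentheses and empty boxes in $[1,2n]$ as closed parentheses, each occupied box $i$ is matched with an empty box $j>i$ (usual parenthesis matching). The planar rooted tree of $\varepsilon$ has a root and one further node for each matched pair $(i,j)$. The parent of $(i,j)$ is the innermost matched pair $(i',j')$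 with $i'<i<j<j'$, or the root if there is none. Children are ordered from left to right by position. (Equivalently: one node for each connected component of the region below the graph of $\varepsilon$ cut by the horizontal lines at integer heights, the bottom component being the root, with edges between components sharing a piece of horizontal line.) **Branches.** Each leaf (non-root node without children) has height $1$ and its own distinct color; a non-root node with children has height $g+1$, where $g$ is the largest height among its children, and receives the color of the rightmost child among those of height $g$. The root has a separate color. A $k$-branch is the set of all nodes of a given (non-root) color when this set has $k$ nodes; it is a path from a top node (the one closest to the root) down to a leaf. **Slots$^*$ of trees.** Let $m$ be the largest branch size (the number of non-root nodes on a longest path from the root to a leaf; $m=0$ if the tree is just the root). For $0\le k\le m$ let $\mathcal T_k$ be the planar tree obtained by removing all $\ell$-branches with $\ell\le k$; it consists of the root and all branches of size larger than $k$. Draw each node of $\mathcal T_k$ as a circle, with its incident edges meeting the circle at distinct points: the edge to its parent from below (by convention the root also has an edge incident from below) and the edges to its children ordered from left to right (clockwise). A node with $c$ children in $\mathcal T_k$ thus has $c+1$ arcs, called slots$^*$. For $1\le k\le m$, a slot$^*$ $\mathtt s$ of $\mathcal T_k$ is a $k$-slot$^*$ if one of the following holds: (a) $\mathtt s$ belongs to the root; (b) $\mathtt s$ belongs to a node that has more than $k$ generations of descendants in $\mathcal T_k$ (height larger than $k+1$); (c) $\mathtt s$ belongs to a node having exactly $k$ generations of descendants in $\mathcal T_k$ (height $k+1$), and every path with $k$ nodes that starts at a child of that node and descends to a leaf is incident to the node to the right of $\mathtt s$. In particular the whole circle of the root is the unique $m$-slot$^*$. The $k$-slots$^*$ are numbered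 $0,1,\dots,s_k^*-1$ from left to right, i.e. in the order in which they are met when going around the tree clockwise starting from the left side of the root. **Slot diagram $x^*[\varepsilon]$.** A $k$-branch is attached to $k$-slot$^*$ number $i$ if, in the tree $\mathcal T_{k-1}$ (which is $\mathcal T_k$ together with the $k$-branches), the edge joining the top node of the $k$-branch to its parent meets the parent's circle inside the arc that is $k$-slot$^*$ number $i$ of $\mathcal T_k$. Let $x^*_k(i)$ be the number of $k$-branches attached to $k$-slot$^*$ number $i$, and $x^*[\varepsilon]=\big((x^*_k(0),\dots,x^*_k(s^*_k-1)):k=1,\dots,m\big)$. *)

(* Defs.v *)
From mathcomp Require Import all_boot.

Set Implicit Arguments.
Unset Strict Implicit.
Unset Printing Implicit Defensive.

Definition soft_excursion (n : nat) (e : seq nat) : Prop :=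
  [/\ size e = n.*2.+1, nth 0 e 0 = 0, nth 0 e n.*2 = 0
    & forall i, 1 <= i <= n.*2 ->
        nth 0 e i = (nth 0 e i.-1).+1 \/ nth 0 e i.-1 = (nth 0 e i).+1].

(* Boxes are represented by natural numbers.  The boxes of Z outside [1, 2n]
   are all empty and are never deleted in the constructions below, so that
   box 0 stands for the half-line ]-oo, 0] and box 2n+1 for [2n+1, +oo[. *)
Definition ball_config (n : nat) (e : seq nat) (i : nat) : bool :=
  (1 <= i <= n.*2) && (nth 0 e i == (nth 0 e i.-1).+1).

Section HeadTail.

Variables (n : nat) (eta : nat -> bool).

(* The runs, from left to right, of an increasing sequence of boxes. *)
Fixpoint runs (s : seq nat) : seq (seq nat) :=
  if s is b :: s' then
    if runs s' is (c :: r) :: rs then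
      if eta b == eta c then (b :: c :: r) :: rs
      else [:: b] :: (c :: r) :: rs
    else [:: [:: b]]
  else [::].

(* The size of a run is +oo when it contains one of the two half-lines. *)
Definition finite_run (r : seq nat) : bool :=
  (0 \notin r) && (n.*2.+1 \notin r).

Definition smallest_run (rs : seq (seq nat)) (r : seq nat) : bool :=
  finite_run r && all (fun r' => finite_run r' ==> (size r <= size r')) rs.

(* A soliton is the pair of the increasing sequences of its occupied boxes
   h_1 < ... < h_k and of its empty boxes t_1 < ... < t_k. *)
Definition soliton : Type := (seq nat * seq nat)%type.

Definition soliton_size (g : soliton) : nat := size g.1.
Definition soliton_boxes (g : soliton) : seq nat := g.1 ++ g.2.
Definition soliton_h (g : soliton) (l : nat) : nat := nth 0 g.1 l.-1.
Definition soliton_t (g : soliton) (l : nat) : nat := nth 0 g.2 l.-1.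

Definition next_soliton (rs : seq (seq nat)) : soliton :=
  let j := find (smallest_run rs) rs in
  let r := nth [::] rs j in
  let k := size r in
  if eta (head 0 r) then (r, take k (nth [::] rs j.+1))
  else let r' := nth [::] rs j.-1 in (drop (size r' - k) r', r).

Fixpoint HT_rec (fuel : nat) (rem : seq nat) : seq soliton :=
  if fuel is fuel'.+1 then
    let rs := runs rem in
    if size rs <= 1 then [::]
    else let g := next_soliton rs in
         g :: HT_rec fuel' [seq b <- rem | b \notin soliton_boxes g]
  else [::].

(* Each soliton takes at least two of the boxes of [1, 2n], hence n steps
   suffice.  When eta is the ball configuration of an excursion the remaining
   boxes of [1, 2n] always form a balanced word, so that no box of the
   half-lines is ever paired. *)
Definition HT_solitons : seq soliton := HT_rec n (iota 0 n.*2.+2).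

Definition HT_slot (k b : nat) : bool :=
  (b == 0) ||
  has (fun g => let m := soliton_size g in
         (k < m) &&
         has (fun l => (b == soliton_h g l) || (b == soliton_t g (m - l).+1))
             (iota 1 (m - k)))
      HT_solitons.

Definition HT_slots (k : nat) : seq nat :=
  [seq b <- iota 0 n.*2.+1 | HT_slot k b].

(* The default value of nth is the next record, i.e. the slot after the last. *)
Definition HT_attached (k i : nat) (g : soliton) : bool :=
  all (fun b => nth n.*2.+1 (HT_slots k) i < b < nth n.*2.+1 (HT_slots k) i.+1)
      (soliton_boxes g).

Definition HT_entry (k i : nat) : nat :=
  count (fun g => (soliton_size g == k) && HT_attached k i g) HT_solitons.

Definition HT_max : nat := \max_(g <- HT_solitons) soliton_size g.

Definition HT_diagram : seq (seq nat) :=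
  [seq [seq HT_entry k i | i <- iota 0 (size (HT_slots k))]
     | k <- iota 1 HT_max].

End HeadTail.

Section ExcursionTree.

Variables (n : nat) (eta : nat -> bool).

Definition occupied (i j : nat) : nat := count eta (index_iota i j.+1).
Definition empty (i j : nat) : nat := count (predC eta) (index_iota i j.+1).

(* Parenthesis matching: j is the first box at which the word starting at the
   open parenthesis i is balanced. *)
Definition matched (i j : nat) : bool :=
  [&& 0 < i, i < j, j <= n.*2, occupied i j == empty i j
    & all (fun l => empty i l < occupied i l) (index_iota i j)].

Definition node : Type := (nat * nat)%type.

(* The root is encoded by the pair made of the two records surrounding the
   excursion; it encloses every matched pair. *)
Definition root : node := (0, n.*2.+1).

(* The non-root nodes, ordered by their open parenthesis: a node comes before
   its descendants, and siblings are ordered from left to right. *)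
Definition nodes : seq node :=
  [seq v <- [seq (i, j) | i <- iota 1 n.*2, j <- iota 1 n.*2]
     | matched v.1 v.2].

Definition encloses (v w : node) : bool := (v.1 < w.1) && (w.2 < v.2).

(* The innermost enclosing pair is the one with the largest open parenthesis. *)
Definition parent (w : node) : node :=
  last root [seq v <- nodes | encloses v w].

(* A planar tree obtained from the tree of the excursion by removing nodes is
   given by the sequence ns of its non-root nodes. *)
Definition children (ns : seq node) (v : node) : seq node :=
  [seq w <- ns | parent w == v].

(* There are n non-root nodes, which bounds the depth of all recursions. *)
Fixpoint height_rec (fuel : nat) (ns : seq node) (v : node) : nat :=
  if fuel is fuel'.+1 then
    (\max_(w <- children ns v) height_rec fuel' ns w).+1
  else 0.

Definition height (ns : seq node) (v : node) : nat := height_rec n.+1 ns v.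

(* Colors are identified with the leaves. *)
Fixpoint color_rec (fuel : nat) (v : node) : node :=
  if fuel is fuel'.+1 then
    let ch := children nodes v in
    if ch is [::] then v
    else let g := \max_(w <- ch) height nodes w in
         color_rec fuel' (last v [seq w <- ch | height nodes w == g])
  else v.

Definition color (v : node) : node := color_rec n v.

Definition leaves : seq node := [seq v <- nodes | children nodes v == [::]].

(* The nodes of a branch are listed from its top node down to its leaf. *)
Definition branch (c : node) : seq node := [seq v <- nodes | color v == c].
Definition branch_size (c : node) : nat := size (branch c).
Definition branch_top (c : node) : node := head root (branch c).

Definition max_branch : nat := \max_(c <- leaves) branch_size c.

Definition pruned (k : nat) : seq node :=
  [seq v <- nodes | k < branch_size (color v)].

(* The arc (v, p) of the circle of v lies between the edges to the children
   number p-1 and p of v, numbered from 0; the parent edge is located before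
   the first and after the last child. *)
Definition arc : Type := (node * nat)%type.

Fixpoint contour_rec (fuel : nat) (ns : seq node) (v : node) : seq arc :=
  if fuel is fuel'.+1 then
    let ch := children ns v in
    (v, 0) :: flatten [seq rcons (contour_rec fuel' ns (nth root ch q)) (v, q.+1)
                         | q <- iota 0 (size ch)]
  else [::].

Definition contour (ns : seq node) : seq arc := contour_rec n.+1 ns root.

Fixpoint path_to_leaf (ns : seq node) (k : nat) (v : node) : bool :=
  match k with
  | 0 => false
  | 1 => children ns v == [::]
  | k'.+1 => has (path_to_leaf ns k') (children ns v)
  end.

Definition tree_slot (k : nat) (s : arc) : bool :=
  let: (v, p) := s in
  let ns := pruned k in
  let ch := children ns v in
  [|| v == root,
      k.+1 < height ns v
    | (height ns v == k.+1) &&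
      all (fun q => path_to_leaf ns k (nth root ch q) ==> (p <= q))
          (iota 0 (size ch))].

Definition tree_slots (k : nat) : seq arc :=
  [seq s <- contour (pruned k) | tree_slot k s].

(* In the tree of pruned k.-1, the edge to the top node of the branch meets the
   circle of its parent v after the edges to exactly p of the children of v
   belonging to pruned k. *)
Definition tree_attached (k : nat) (s : arc) (c : node) : bool :=
  let: (v, p) := s in
  let u := branch_top c in
  let ch := children (pruned k.-1) v in
  (u \in ch) && (count (mem (pruned k)) (take (index u ch) ch) == p).

Definition tree_entry (k i : nat) : nat :=
  count (fun c => (branch_size c == k) &&
                  tree_attached k (nth (root, 0) (tree_slots k) i) c)
        leaves.

Definition tree_diagram : seq (seq nat) :=
  [seq [seq tree_entry k i | i <- iota 0 (size (tree_slots k))]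
     | k <- iota 1 max_branch].

End ExcursionTree.

Definition x_diamond (n : nat) (e : seq nat) : seq (seq nat) :=
  HT_diagram n (ball_config n e).

Definition x_star (n : nat) (e : seq nat) : seq (seq nat) :=
  tree_diagram n (ball_config n e).

(* Main.v *)
Require Import Defs.
From mathcomp Require Import all_boot zify.

(** The two decompositions cut the tree of the excursion into the same pieces,
    and both slot diagrams record where the k-branches are located among the
    nodes of height larger than k.

    Solitons are branches. Deleting matched pairs preserves the matching, and
    among the boxes that remain an occupied box followed by an empty one is
    always a matched pair ([adjacent_node]). The two halves of a soliton are
    contiguous, so they are the ends of k nested nodes, which form the lower
    end of a single branch ([seam], [block_color]). They form the whole branch
    because of the choice of the leftmost smallest run: the run next to it,
    which is at least as long, contains the ends of another descendant of the
    parent of these nodes, if it is not the root, and this descendant takes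
    precedence in the coloring ([next_solitonP]). Hence the solitons are, up to order, the branches
    ([HT_solitons_perm]).

    Slots. Heights decrease by one along a branch, so the condition on the
    index l in the definition of a k-slot of the excursion says that the node
    whose end is considered is higher than k: besides box 0, the k-slots are
    the ends of the nodes of height larger than k. On the tree side, send the
    arc of a node v before its first child to the opening box of v, and the
    arc that follows a child to the closing box of this child. Going around the
    tree becomes reading the boxes from left to right, and the k-slots of the
    tree are sent onto the same boxes ([tree_slots_boxes]).

    Attachment. The top u of a k-branch has height k, so no end of a higher
    node lies inside u, and the branch sits between two consecutive slots. The
    slot on its left is the box of the arc to which the tree attaches it
    ([attach_boxP], [attach_box_max]). *)

Set Implicit Arguments.
Unset Strict Implicit.
Unset Printing Implicit Defensive.

Implicit Types u v w p q c : node.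

Local Notation starts_before := (fun v w : node => v.1 < w.1).

(** * Sorted sequences *)

Lemma pairwise_fst_allpairs (s t : seq nat) : pairwise leq s ->
  pairwise (fun v w : node => v.1 <= w.1) [seq (i, j) | i <- s, j <- t].
Proof.
elim: s => //= i s IHs /andP[/allP si ss]; rewrite pairwise_cat IHs // andbT.
apply/andP; split.
  apply/allrelP=> _ _ /mapP[j _ ->] /allpairsP[[i' j'] /= [i's _ ->]] /=.
  exact: si.
by rewrite pairwise_map; elim: t {IHs} => //= j t ->; rewrite andbT; apply/allP=> y _ /=.
Qed.

Lemma last_pairwise (T : eqType) (r : rel T) x0 s x :
  pairwise r s -> x \in s -> x = last x0 s \/ r x (last x0 s).
Proof.
case/lastP: s => // s y; rewrite last_rcons pairwise_rcons => /andP[/allP sy _].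
by rewrite mem_rcons inE => /predU1P[->|/sy]; [left | right].
Qed.

Lemma bigmax_attained (T : eqType) (s : seq T) (f : T -> nat) : s != [::] ->
  exists2 x, x \in s & f x = \max_(y <- s) f y.
Proof.
elim: s => // x s IHs _; rewrite big_cons.
have [->|/IHs[y ys <-]] := eqVneq s [::].
  by exists x; rewrite ?mem_head // big_nil maxn0.
have [xy|yx] := leqP (f x) (f y).
  by exists y; rewrite ?inE ?ys ?orbT //; lia.
by exists x; rewrite ?mem_head //; lia.
Qed.

Lemma map_uniq_inj (T1 T2 : eqType) (f : T1 -> T2) (s : seq T1) :
  uniq (map f s) -> {in s &, injective f}.
Proof.
elim: s => //= x s IHs /andP[fx us] y z; rewrite !inE.
case/predU1P=> [->|ys] /predU1P[->|zs] // E; last exact: IHs.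
- by rewrite E map_f in fx.
- by rewrite -E map_f in fx.
Qed.

Lemma head_in (T : eqType) (x0 : T) (r : seq T) : r != [::] -> head x0 r \in r.
Proof. by case: r => // x s _; rewrite mem_head. Qed.

Lemma last_in (T : eqType) (x0 : T) (r : seq T) : r != [::] -> last x0 r \in r.
Proof. by case: r => // x s _; rewrite /= mem_last. Qed.

Lemma sorted_head_leq (s : seq nat) x : pairwise ltn s -> x \in s -> head 0 s <= x.
Proof.
case: s => //= y s /andP[/allP ys _]; rewrite inE => /predU1P[->//|/ys]; exact: ltnW.
Qed.

Lemma sorted_leq_last (s : seq nat) x : pairwise ltn s -> x \in s -> x <= last 0 s.
Proof. by move=> ss xs; have [->|/ltnW] := last_pairwise 0 ss xs. Qed.

Lemma filter_prefix (s : seq node) a : pairwise starts_before s ->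
  [seq x <- s | x.1 < a] = take (count (fun x : node => x.1 < a) s) s.
Proof.
elim: s => //= x s IHs /andP[/allP xs /IHs E]; case: ltnP => xa /=; first by rewrite E.
have H : {in s, (fun y : node => y.1 < a) =1 pred0}.
  by move=> y /xs /= xy; rewrite ltnNge (leq_trans xa) // ltnW.
by rewrite (eq_in_filter H) (eq_in_count H) filter_pred0 count_pred0.
Qed.

Lemma take_index_prefix (s : seq node) u : pairwise starts_before s ->
  u \in s -> take (index u s) s = [seq x <- s | x.1 < u.1].
Proof.
elim: s => //= x s IHs /andP[/allP xs ss]; rewrite inE eq_sym; case: eqP => [<-|_] /= us.
  rewrite ltnn -(filter_pred0 s); apply: eq_in_filter => y /xs /= xy.
  by rewrite ltnNge ltnW.
by rewrite IHs // (xs _ us).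
Qed.

Lemma flatten_sorted (ws : seq node) (F : node -> seq nat) :
  {in ws, forall w, pairwise ltn (F w) /\ {in F w, forall b, w.1 <= b <= w.2}} ->
  pairwise (fun w w' : node => w.2 < w'.1) ws -> pairwise ltn (flatten (map F ws)).
Proof.
elim: ws => //= w ws IHws hF /andP[/allP ww' sws].
rewrite pairwise_cat (hF w (mem_head _ _)).1 IHws ?andbT //=; last first.
  by move=> x xs; apply: hF; rewrite inE xs orbT.
apply/allrelP => a b aw /flatten_mapP[w' w's bw'].
have [_ /(_ a aw)/andP[_ h1]] := hF w (mem_head _ _).
have [_ /(_ b bw')/andP[h2 _]] := hF w' ltac:(by rewrite inE w's orbT).
exact: leq_ltn_trans h1 (leq_trans (ww' _ w's) h2).
Qed.

(** * Nesting of pairs of boxes *)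

Definition contains (v w : node) : bool := (v == w) || encloses v w.

Lemma containsE v w : contains v w -> v.1 <= w.1 /\ w.2 <= v.2.
Proof. by case/orP=> [/eqP->|/andP[]] //; lia. Qed.

Lemma contains_refl v : contains v v.
Proof. by rewrite /contains eqxx. Qed.

Lemma encloses_trans : transitive encloses.
Proof. by move=> v u w; rewrite /encloses; lia. Qed.

Lemma encloses_irr v : encloses v v = false.
Proof. by rewrite /encloses; lia. Qed.

Lemma contains_enc_trans u v w : contains u v -> encloses v w -> encloses u w.
Proof. by case/predU1P=> [->|/encloses_trans]//; apply. Qed.

Lemma enc_contains_trans u v w : encloses u v -> contains v w -> encloses u w.
Proof. by move=> uv /predU1P[<-|/(encloses_trans uv)]. Qed.

Lemma contains_trans u v w : contains u v -> contains v w -> contains u w.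
Proof.
by case/predU1P=> [->//|uv vw]; rewrite /contains (enc_contains_trans uv vw) orbT.
Qed.

Lemma contains_anti v w : contains v w -> contains w v -> v = w.
Proof.
case/predU1P=> [//|vw] /(enc_contains_trans vw); by rewrite encloses_irr.
Qed.

(** * Parenthesis matching of an excursion *)

(** What the tree and the runs depend on: the matched pairs do not cross, and
    each box of the excursion is an end of one of them. *)
Record noncrossing (n : nat) (eta : nat -> bool) : Prop := Noncrossing {
  records_empty : (~~ eta 0) && ~~ eta n.*2.+1;
  node_ends : forall v, v \in nodes n eta ->
    [/\ 0 < v.1, v.1 < v.2, v.2 <= n.*2, eta v.1 & ~~ eta v.2];
  node_start_inj : forall v w, v \in nodes n eta -> w \in nodes n eta ->
    v.1 = w.1 -> v = w;
  node_laminar : forall v w, v \in nodes n eta -> w \in nodes n eta ->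
    v.1 < w.1 -> v.2 < w.1 \/ w.2 < v.2;
  node_cover : forall b, 0 < b <= n.*2 ->
    exists2 v : node, v \in nodes n eta & b = v.1 \/ b = v.2 }.

Section Matching.

Variables (n : nat) (e : seq nat).
Hypothesis he : soft_excursion n e.
Let eta := ball_config n e.
Let E := nth 0 e.

Lemma eta_step i : 0 < i <= n.*2 ->
  if eta i then E i = (E i.-1).+1 else E i.-1 = (E i).+1.
Proof.
move=> hi; have [_ _ _ /(_ i hi)] := he.
by rewrite /eta /ball_config hi /= -/E => -[->|->]; rewrite ?eqxx //; case: eqP; lia.
Qed.

(** The counts that define matching telescope along the path, so that matching
    can be read on the path: j is the first box after i at which the path is back
    to its value before box i. *)
Lemma E_occupied_empty i j : 0 < i -> i <= j.+1 -> j <= n.*2 ->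
  E j + empty eta i j = E i.-1 + occupied eta i j.
Proof.
move=> i0; elim: j => [|j IHj] ij jn.
  have -> : i = 1 by lia.
  by rewrite /empty /occupied /index_iota.
have [->|ij'] := eqVneq i j.+2.
  by rewrite /empty /occupied /index_iota subnn.
have := IHj ltac:(lia) ltac:(lia).
rewrite /empty /occupied /index_iota.
rewrite [in X in _ -> X](_ : j.+2 - i = (j.+1 - i) + 1); last by lia.
rewrite iotaD !count_cat /= (_ : i + (j.+1 - i) = j.+1); last by lia.
have := @eta_step j.+1 ltac:(lia); rewrite /=; case: (eta j.+1) => /=; lia.
Qed.

Lemma matchedP i j :
  reflect [/\ 0 < i, i < j, j <= n.*2, E j = E i.-1
            & forall l, i <= l < j -> E i.-1 < E l] (matched n eta i j).
Proof.
apply: (iffP and5P) => [[i0 ij jn /eqP oe /allP al]|[i0 ij jn oe al]]; split=> //.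
- have := @E_occupied_empty i j; lia.
- move=> l il; have := al l; rewrite mem_index_iota => /(_ il).
  have := @E_occupied_empty i l; lia.
- by apply/eqP; have := @E_occupied_empty i j; lia.
- apply/allP=> l; rewrite mem_index_iota => il; have := al l il.
  have := @E_occupied_empty i l; lia.
Qed.

Lemma mem_nodes v : (v \in nodes n eta) = matched n eta v.1 v.2.
Proof.
case: v => i j; rewrite mem_filter /=.
case m: (matched _ _ _ _) => //=; have [i0 ij jn _ _] := matchedP _ _ m.
by apply/allpairsP; exists (i, j); rewrite /= !mem_iota; split=> //; lia.
Qed.

Lemma eta_start i : 0 < i <= n.*2 -> eta i = (E i.-1 < E i).
Proof. by move=> /eta_step; case: (eta i); lia. Qed.

(** Each of these facts comes from comparing the values of the path on two
    intervals. A box is an end of a matched pair because its partner is the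
    first return of the path to the level below an up-step, respectively the
    last visit to that level before a down-step. *)
Lemma matching_noncrossing : noncrossing n eta.
Proof.
have [_ E0 E2n _] := he; rewrite -/E in E0 E2n.
split.
- by rewrite /eta /ball_config /= ltnn.
- case=> i j; rewrite mem_nodes => /matchedP /= [i0 ij jn Ej al].
  split=> //; rewrite eta_start ?Ej; try lia; first by apply: al; lia.
  by have := al j.-1; lia.
- case=> i j [i' j']; rewrite !mem_nodes => /matchedP /= [i0 ij jn Ej al].
  move=> /matchedP /= [i0' ij' jn' Ej' al'] ii; move: ij' Ej' al'; rewrite -ii.
  move=> ij' Ej' al'; congr pair; have := al j'; have := al' j; lia.
- case=> i j [i' j']; rewrite !mem_nodes => /matchedP /= [i0 ij jn Ej al].
  move=> /matchedP /= [i0' ij' jn' Ej' al'] ii.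
  have := al i'.-1; have := al' j.
  have [ij'E|] := eqVneq i' j; first by subst i'; have := al j.-1; lia.
  have [jj'E|] := eqVneq j' j; last by lia.
  by subst j'; lia.
- move=> b hb; have := eta_step hb; case hE: (eta b) => Eb.
  + (* The partner of b is the first box after b where the path is back. *)
    pose P j := (b < j) && (E j <= E b.-1).
    have bn : b < n.*2.
      by have [bE|] := eqVneq b n.*2; [rewrite bE E2n in Eb | lia].
    have Pn : P n.*2 by rewrite /P E2n bn.
    have exP : exists j, P j by exists n.*2.
    case: (ex_minnP exP) => j /andP[bj Ejb] jmin.
    have jn := jmin _ Pn.
    have low l : b <= l < j -> E b.-1 < E l.
      have [<-|] := eqVneq b l; first by lia.
      by have := jmin l; rewrite /P; lia.
    exists (b, j); last by left.
    rewrite mem_nodes; apply/matchedP; split=> //=; try lia.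
    by have := low j.-1; have := @eta_step j; case: (eta j); lia.
  + (* The partner of b follows the last position before b at level E b. *)
    pose P i := (i < b) && (E i <= E b).
    have exP : exists i, P i by exists 0; rewrite /P E0; lia.
    have leP i : P i -> i <= b by rewrite /P; lia.
    case: (ex_maxnP exP leP) => i /andP[ib Eib] imax.
    have low l : i < l < b -> E b < E l by have := imax l; rewrite /P; lia.
    have ib' : i.+1 != b.
      by apply/eqP=> ib'; move: Eb; rewrite -ib' /= => Eb; rewrite -ib' in Eib; lia.
    exists (i.+1, b); last by right.
    rewrite mem_nodes; apply/matchedP; rewrite /=.
    have Ei : E b = E i.
      by have := low i.+1; have := @eta_step i.+1; rewrite /=; case: (eta i.+1); lia.
    by split=> //; try lia; move=> l; rewrite -Ei => il; apply: low; lia.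
Qed.

End Matching.

(** * The planar tree of a noncrossing matching *)

Section Forest.

Variables (n : nat) (eta : nat -> bool).
Hypothesis nc : noncrossing n eta.

Local Notation nds := (nodes n eta).
Local Notation rt := (Defs.root n).
Local Notation par := (parent n eta).
Local Notation kids := (children n eta).
Local Notation ht := (height n eta nds).
Local Notation col := (color n eta).

Lemma nodes_uniq : uniq nds.
Proof.
rewrite filter_uniq // allpairs_uniq ?iota_uniq //.
by move=> [a b] [c d].
Qed.

Lemma nodes_sorted : pairwise starts_before nds.
Proof.
have le : pairwise (fun v w : node => v.1 <= w.1) nds.
  apply/pairwise_filter/pairwise_fst_allpairs.
  by rewrite -sorted_pairwise ?iota_sorted //; apply: leq_trans.
have ne : pairwise (fun v w : node => v != w) nds.
  by have := nodes_uniq; rewrite uniq_pairwise.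
have := conj le ne => /andP.
rewrite -pairwise_relI; apply: (@sub_in_pairwise _ (mem nds)); last by apply/allP.
move=> v w vn wn /= /andP[vw /eqP nvw]; rewrite ltn_neqAle vw andbT.
by apply/eqP => /(node_start_inj nc vn wn).
Qed.

Lemma node_bounds v : v \in nds -> [/\ 0 < v.1, v.1 < v.2 & v.2 <= n.*2].
Proof. by case/(node_ends nc). Qed.

Lemma rooted v : v \in nds -> v \in rt :: nds.
Proof. by rewrite inE orbC => ->. Qed.

Lemma root_enc w : w \in nds -> encloses rt w.
Proof. by case/node_bounds; rewrite /encloses /Defs.root /=; lia. Qed.

Lemma root_notin : rt \notin nds.
Proof. by apply/negP=> /node_bounds[]. Qed.

Lemma ends_neq v w : v \in nds -> w \in nds -> v.1 <> w.2.
Proof.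
by move=> /(node_ends nc)[_ _ _ ev _] /(node_ends nc)[_ _ _ _ ew] E; rewrite -E ev in ew.
Qed.

(** The root is treated as one more pair, which encloses every node: this is
    why nodes and root are handled together, as members of rt :: nds. *)
Lemma laminar v w : v \in rt :: nds -> w \in nds -> v.1 < w.1 ->
  v.2 < w.1 \/ encloses v w.
Proof.
rewrite inE => /predU1P[->|vn] wn vw; first by right; apply: root_enc.
by case: (node_laminar nc vn wn vw); rewrite /encloses; lia.
Qed.

Lemma node_end_inj v w : v \in nds -> w \in nds -> v.2 = w.2 -> v = w.
Proof.
move=> vn wn E; apply: (node_start_inj nc vn wn).
have [_ hv _] := node_bounds vn; have [_ hw _] := node_bounds wn.
have [vw|wv|//] := ltngtP v.1 w.1.
  by have := node_laminar nc vn wn vw; lia.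
by have := node_laminar nc wn vn wv; lia.
Qed.

Lemma enc_start v w : v \in rt :: nds -> w \in nds -> v.1 < w.1 < v.2 -> encloses v w.
Proof. by move=> vn wn vw; case: (laminar vn wn); lia. Qed.

Lemma enc_end v w : v \in rt :: nds -> w \in nds -> v.1 < w.2 < v.2 -> encloses v w.
Proof.
rewrite inE => /predU1P[->|vn] wn vw; first exact: root_enc.
apply: enc_start; rewrite ?rooted //.
have [_ hw _] := node_bounds wn.
case: (ltngtP v.1 w.1) => [||E]; first by lia.
- by move=> wv; have := node_laminar nc wn vn wv; have := ends_neq vn wn; lia.
- by rewrite (node_start_inj nc vn wn E) in vw; lia.
Qed.

(** Two pairs around a common node cannot be disjoint, so they are nested. *)
Lemma comparable u v w : u \in rt :: nds -> v \in rt :: nds ->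
  contains u w -> contains v w -> w \in nds -> contains u v \/ encloses v u.
Proof.
rewrite !inE => /predU1P[->|un] /predU1P[->|vn] uw vw wn.
- by left; rewrite contains_refl.
- by left; rewrite /contains root_enc ?orbT.
- by right; rewrite root_enc.
have := containsE uw; have := containsE vw; have [_ ? _] := node_bounds wn.
have [uv|vu|E] := ltngtP u.1 v.1.
- by have := node_laminar nc un vn uv; rewrite /contains /encloses; left; lia.
- by have := node_laminar nc vn un vu; rewrite /contains /encloses; right; lia.
- by left; rewrite (node_start_inj nc un vn E) contains_refl.
Qed.

(** The nodes are sorted by their first box and two pairs around w are nested,
    so the last pair that encloses w is the innermost one. *)
Lemma parP w : w \in nds ->
  [/\ par w \in rt :: nds, encloses (par w) w
    & forall v, v \in rt :: nds -> encloses v w -> contains v (par w)].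
Proof.
move=> wn; rewrite /parent; set L := [seq v <- _ | _].
have memL v : (v \in L) = encloses v w && (v \in nds) by rewrite mem_filter.
have lastL : last rt L = rt /\ L = [::] \/ last rt L \in L.
  by case: (L) => [|x s]; [left | right; rewrite /= mem_last].
have inL : last rt L \in rt :: nds.
  by case: lastL => [[-> _]|]; rewrite ?mem_head // memL inE orbC => /andP[_ ->].
have encL : encloses (last rt L) w.
  by case: lastL => [[-> _]|]; [apply: root_enc | rewrite memL => /andP[]].
split=> // v vn vw; move: (vn); rewrite inE => /predU1P[->|vn'].
  move: inL; rewrite inE => /predU1P[->|/root_enc]; first exact: contains_refl.
  by rewrite /contains => ->; rewrite orbT.
have vL : v \in L by rewrite memL vw.
have Ls : pairwise starts_before L.
  by apply/pairwise_filter/nodes_sorted.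
have [->|lt] := last_pairwise rt Ls vL; first by rewrite contains_refl.
have [||//|//|] := comparable vn inL (w := w); rewrite ?/contains ?vw ?encL ?orbT //.
by case/andP=> /(ltn_trans lt); rewrite ltnn.
Qed.

Lemma par_in w : w \in nds -> par w \in rt :: nds. Proof. by case/parP. Qed.
Lemma par_enc w : w \in nds -> encloses (par w) w. Proof. by case/parP. Qed.
Lemma par_least w v : w \in nds -> v \in rt :: nds -> encloses v w -> contains v (par w).
Proof. by case/parP=> _ _; apply. Qed.

(** Subtrees that contain the root: the parent of a node that is kept is kept. *)
Definition upward (ns : seq node) : Prop :=
  forall w, w \in ns -> w \in nds /\ par w \in rt :: ns.

Lemma upward_nodes : upward nds.
Proof. by move=> w wn; rewrite par_in. Qed.

Lemma mem_kids ns v w : (w \in kids ns v) = (par w == v) && (w \in ns).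
Proof. by rewrite mem_filter. Qed.

(** Climbing from w through parents, one passes by a child of v. *)
Lemma child_containing ns v w : upward ns -> v \in rt :: nds -> w \in ns -> encloses v w ->
  exists2 q : node, q \in kids ns v & contains q w.
Proof.
move=> up vn; have [m] := ubnP (v.2 - v.1 - (w.2 - w.1)).
elim: m w => // m IHm w lt wns vw; have [wn pns] := up _ wns.
have /predU1P[E|vp] := par_least wn vn vw.
  by exists w; rewrite ?mem_kids -?E ?eqxx ?wns ?contains_refl.
have pns' : par w \in ns.
  move: pns; rewrite inE => /predU1P[E|//]; move: vn vp; rewrite E inE.
  by case/predU1P=> [->|/root_enc]; rewrite ?encloses_irr // /encloses /Defs.root /=; lia.
have [|//|//|q qk qp] := IHm (par w).
  by move: (par_enc wn) vp lt; rewrite /encloses; have [_ ? _] := node_bounds wn; lia.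
by exists q => //; rewrite /contains (contains_enc_trans qp (par_enc wn)) orbT.
Qed.

Lemma kid_enc ns v w : upward ns -> w \in kids ns v -> encloses v w.
Proof. by move=> up; rewrite mem_kids => /andP[/eqP<- /up[/par_enc]]. Qed.

Lemma kid_node v w : w \in kids nds v -> w \in nds.
Proof. by rewrite mem_kids => /andP[]. Qed.

Lemma siblings v w : v \in nds -> w \in nds -> par v = par w -> v.1 < w.1 -> v.2 < w.1.
Proof.
move=> vn wn E vw; have [//|evw] := laminar (rooted vn) wn vw.
have := par_least wn (rooted vn) evw.
by move=> /containsE; have := par_enc vn; rewrite -E /encloses; lia.
Qed.

Lemma kids_disjoint v q q' w : q \in kids nds v -> q' \in kids nds v -> w \in nds ->
  contains q w -> contains q' w -> q = q'.
Proof.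
rewrite !mem_kids => /andP[/eqP pq qn] /andP[/eqP pq' qn'] wn.
have [_ hw _] := node_bounds wn => /containsE cq /containsE cq'.
apply: (node_start_inj nc) => //; have [lt|lt|//] := ltngtP q.1 q'.1.
  by have := siblings qn qn' _ lt; rewrite pq pq' => /(_ erefl); lia.
by have := siblings qn' qn _ lt; rewrite pq pq' => /(_ erefl); lia.
Qed.

(** * Heights *)

(** Each descent to a child shortens the pair by at least two boxes, so any
    amount of fuel larger than half the length of the pair gives the same
    result. *)
Lemma height_rec_fuel ns f g v : upward ns -> v.2 - v.1 < f.*2 -> v.2 - v.1 < g.*2 ->
  height_rec n eta f ns v = height_rec n eta g ns v.
Proof.
move=> up; elim: f g v => [|f IHf] [|g] v //= fv gv.
have IH w : w \in kids ns v -> height_rec n eta f ns w = height_rec n eta g ns w.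
  move=> /[dup] /(kid_enc up) vw; rewrite mem_kids => /andP[_ /up[/node_bounds[_ ? _] _]].
  by rewrite /encloses in vw; apply: IHf; lia.
by congr _.+1; apply: eq_big_seq.
Qed.

Lemma heightE ns v : upward ns -> v \in rt :: nds ->
  height n eta ns v = (\max_(w <- kids ns v) height n eta ns w).+1.
Proof.
move=> up vn; have lt : v.2 - v.1 < n.+1.*2.
  by move: vn; rewrite inE => /predU1P[->|/node_bounds[]]; rewrite /Defs.root /=; lia.
have IH w : w \in kids ns v -> height_rec n eta n ns w = height_rec n eta n.+1 ns w.
  move=> /[dup] /(kid_enc up) vw; rewrite mem_kids => /andP[_ /up[/node_bounds[_ ? _] _]].
  by rewrite /encloses in vw; apply: height_rec_fuel => //; lia.
by rewrite /height [LHS]/=; congr _.+1; apply: eq_big_seq.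
Qed.

Lemma height_kid v w : v \in rt :: nds -> w \in kids nds v -> ht w < ht v.
Proof.
move=> vn wk; rewrite [ht v]heightE //; last exact: upward_nodes.
by rewrite ltnS; apply: leq_bigmax_seq.
Qed.

Hint Resolve upward_nodes : core.

Lemma height_par w : w \in nds -> ht w < ht (par w).
Proof. by move=> wn; apply: height_kid; rewrite ?par_in // mem_kids eqxx. Qed.

Lemma height_enc v w : v \in rt :: nds -> w \in nds -> encloses v w -> ht w < ht v.
Proof.
move=> vn; have [m] := ubnP (v.2 - v.1); elim: m v vn w => // m IHm v vn w lt wn vw.
have [q qk qw] := child_containing upward_nodes vn wn vw.
apply: leq_ltn_trans (height_kid vn qk).
case/predU1P: qw => [->//|qw]; apply/ltnW/IHm => //; first exact/rooted/(kid_node qk).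
have := kid_enc upward_nodes qk; have [_ ? _] := node_bounds (kid_node qk).
by rewrite /encloses; lia.
Qed.

Lemma height_gt0 v : v \in rt :: nds -> 0 < ht v.
Proof. by move=> vn; rewrite heightE. Qed.

(** * Colors and branches *)

(** The child that inherits the color of its parent. *)
Definition heir (v : node) : node :=
  let ch := kids nds v in
  last v [seq w <- ch | ht w == \max_(w <- ch) ht w].

Lemma heirP v : v \in rt :: nds -> kids nds v != [::] ->
  [/\ heir v \in kids nds v, ht v = (ht (heir v)).+1
    & forall w, w \in kids nds v -> ht w <= ht (heir v)
       /\ (ht w = ht (heir v) -> w.1 <= (heir v).1)].
Proof.
move=> vn ch0; rewrite /heir; set g := \max_(w <- _) _; set L := [seq w <- _ | _].
have memL w : (w \in L) = (ht w == g) && (w \in kids nds v) by rewrite mem_filter.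
have [w wk hw] := bigmax_attained ht ch0.
have wL : w \in L by rewrite memL wk hw eqxx.
have lL : last v L \in L by case: (L) wL => // x s _; rewrite /= mem_last.
have /andP[/eqP lg lk] : (ht (last v L) == g) && (last v L \in kids nds v) by rewrite -memL.
have Ls : pairwise starts_before L by do 2!apply/pairwise_filter; apply/nodes_sorted.
split=> //; first by rewrite heightE // lg.
move=> q qk; rewrite lg; split; first exact: leq_bigmax_seq.
move=> hq; have [|->//|] := last_pairwise (x := q) v Ls; first by rewrite memL hq eqxx.
exact: ltnW.
Qed.

Lemma leavesE c : (c \in leaves n eta) = (kids nds c == [::]) && (c \in nds).
Proof. by rewrite mem_filter. Qed.

Lemma leaf_node c : c \in leaves n eta -> c \in nds.
Proof. by rewrite leavesE => /andP[]. Qed.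

Lemma leaf_encN c w : c \in leaves n eta -> w \in nds -> encloses c w = false.
Proof.
rewrite leavesE => /andP[/eqP k0 cn] wn; apply/negP=> cw.
by have [q] := child_containing upward_nodes (rooted cn) wn cw; rewrite k0.
Qed.

Lemma leaf_contains c w : c \in leaves n eta -> w \in nds -> contains c w -> w = c.
Proof. by move=> cl wn; rewrite /contains leaf_encN // orbF => /eqP. Qed.

Lemma color_recS f v : color_rec n eta f.+1 v =
  if kids nds v == [::] then v else color_rec n eta f (heir v).
Proof. by rewrite /= /heir; case: (kids nds v). Qed.

Lemma heir_kid v : v \in nds -> kids nds v != [::] -> heir v \in kids nds v.
Proof. by move=> vn /(heirP (rooted vn))[]. Qed.

Lemma heir_node v : v \in nds -> kids nds v != [::] -> heir v \in nds.
Proof. by move=> vn /(heir_kid vn)/kid_node. Qed.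

Lemma heir_height v : v \in nds -> kids nds v != [::] -> ht v = (ht (heir v)).+1.
Proof. by move=> vn /(heirP (rooted vn))[]. Qed.

Lemma color_rec_fuel f g v : v \in nds -> v.2 - v.1 < f.*2 -> v.2 - v.1 < g.*2 ->
  color_rec n eta f v = color_rec n eta g v.
Proof.
elim: f g v => [|f IHf] [|g] v vn fv gv //.
rewrite !color_recS; case: eqP => // /eqP k0; have hn := heir_node vn k0.
have := kid_enc upward_nodes (heir_kid vn k0); have [_ ? _] := node_bounds hn.
by rewrite /encloses => ?; apply: IHf => //; lia.
Qed.

Lemma color_heir v : v \in nds -> kids nds v != [::] -> col (heir v) = col v.
Proof.
move=> vn k0; have hn := heir_node vn k0; have [? ? ?] := node_bounds vn.
have := kid_enc upward_nodes (heir_kid vn k0); have [_ ? _] := node_bounds hn.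
rewrite /encloses => ?; rewrite /color [RHS](@color_rec_fuel _ n.+1) //; try lia.
by rewrite color_recS (negbTE k0).
Qed.

Lemma color_childless v : kids nds v = [::] -> col v = v.
Proof. by rewrite /color; case: n => // m k0; rewrite /= k0. Qed.

Lemma leaf_color c : c \in leaves n eta -> col c = c.
Proof. by rewrite leavesE => /andP[/eqP/color_childless]. Qed.

(** Induction along a branch, from its leaf up. *)
Lemma heir_ind (P : node -> Prop) :
  (forall v, v \in nds -> kids nds v = [::] -> P v) ->
  (forall v, v \in nds -> kids nds v != [::] -> P (heir v) -> P v) ->
  forall v, v \in nds -> P v.
Proof.
move=> P0 PS v; have [m] := ubnP (ht v); elim: m v => // m IHm v lt vn.
have [k0|k0] := eqVneq (kids nds v) [::]; first exact: P0.
apply: PS => //; apply: IHm; last exact: heir_node.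
by rewrite heir_height in lt.
Qed.

Lemma colorP v : v \in nds -> (col v \in leaves n eta) /\ contains v (col v).
Proof.
move: v; apply: heir_ind => v vn k0.
  by rewrite color_childless // leavesE k0 vn eqxx contains_refl.
rewrite color_heir // => -[cl hc]; split=> //.
by rewrite /contains (enc_contains_trans (kid_enc upward_nodes (heir_kid vn k0)) hc) orbT.
Qed.

Lemma color_leaf v : v \in nds -> col v \in leaves n eta.
Proof. by case/colorP. Qed.

Lemma color_in v : v \in nds -> contains v (col v).
Proof. by case/colorP. Qed.

Lemma color_node v : v \in nds -> col v \in nds.
Proof. by move/color_leaf/leaf_node. Qed.

(** Disjoint subtrees have different leaves, hence different colors: the
    nodes below v that share its color are below its heir. *)
Lemma heir_unique v w q : v \in nds -> kids nds v != [::] -> w \in nds ->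
  col w = col v -> q \in kids nds v -> contains q w -> q = heir v.
Proof.
move=> vn k0 wn cw qk qw; have hk := heir_kid vn k0.
apply: (kids_disjoint qk hk (color_node vn)).
  rewrite -cw; case/predU1P: qw => [->|qw]; first exact: color_in.
  by rewrite /contains (enc_contains_trans qw (color_in wn)) orbT.
by rewrite -(color_heir vn k0); apply/color_in/heir_node.
Qed.

Lemma color_kid v w : v \in nds -> w \in kids nds v -> col w = col v -> w = heir v.
Proof.
move=> vn wk cw; have k0 : kids nds v != [::] by case: (kids nds v) wk.
exact: (heir_unique vn k0 (kid_node wk) cw wk (contains_refl w)).
Qed.

(** A branch loses one node and one unit of height at each step to the heir. *)
Lemma count_subbranch v : v \in nds ->
  count (fun w => (col w == col v) && contains v w) nds = ht v.
Proof.
move: v; apply: heir_ind => v vn k0.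
  rewrite heightE ?rooted // k0 big_nil (eq_in_count (a2 := pred1 v)).
    by rewrite count_uniq_mem ?nodes_uniq // vn.
  move=> w wn /=; have [->|] := eqVneq w v; first by rewrite eqxx contains_refl.
  have vl : v \in leaves n eta by rewrite leavesE k0 eqxx.
  by rewrite /contains leaf_encN // eq_sym => /negbTE->; rewrite andbF.
move=> IH; rewrite heir_height // -IH color_heir //.
have hk := heir_kid vn k0; have vh := kid_enc upward_nodes hk.
pose h w := (col w == col v) && contains (heir v) w.
have disj : predI (pred1 v) h =1 pred0.
  move=> w /=; apply/andP=> -[/eqP-> /andP[_ /containsE]].
  by move: vh; rewrite /encloses; lia.
have := count_predUI (pred1 v) h nds; rewrite (eq_count disj) count_pred0 addn0.
rewrite count_uniq_mem ?nodes_uniq // vn add1n => <-; apply: eq_in_count.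
move=> w wn /=; have [->|wv] := eqVneq w v; first by rewrite eqxx contains_refl.
rewrite /h [contains v w]/contains [v == w]eq_sym (negbTE wv) /=.
case: eqP => //= cw; apply/idP/idP => [vw|/(enc_contains_trans vh)//].
have [q qk qw] := child_containing upward_nodes (rooted vn) wn vw.
by rewrite -(heir_unique vn k0 wn cw qk qw).
Qed.

Lemma branchE c v : (v \in branch n eta c) = (col v == c) && (v \in nds).
Proof. by rewrite mem_filter. Qed.

Lemma height_le_branch v : v \in nds -> ht v <= branch_size n eta (col v).
Proof.
move=> vn; rewrite -count_subbranch // /branch_size size_filter.
by apply: sub_count => w /andP[].
Qed.

(** A node between two nodes of the same color lies on the path of heirs from
    the upper one to the lower one. *)
Lemma color_convex w v : w \in nds -> v \in nds -> encloses w v -> col w = col v ->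
  col (par v) = col v.
Proof.
move=> wn vn; move: w wn; apply: heir_ind => w wn k0.
  by rewrite leaf_encN // leavesE k0 eqxx.
move=> IH wv cw; have /predU1P[<-//|wp] := par_least vn (rooted wn) wv.
have pn : par v \in nds.
  have := par_in vn; rewrite inE => /predU1P[E|//]; move: wp; rewrite E => wr.
  by have := encloses_trans wr (root_enc wn); rewrite encloses_irr.
have [q qk qp] := child_containing upward_nodes (rooted wn) pn wp.
have qv : encloses q v := contains_enc_trans qp (par_enc vn).
have Eq : q = heir w.
  by apply: (@heir_unique w v) => //; rewrite /contains qv orbT.
by apply: IH; rewrite -?Eq // Eq color_heir.
Qed.

Lemma par_nodeN w x : w \in nds -> x \in nds -> encloses x w -> par w \in nds.
Proof.
move=> wn xn xw; have := par_in wn; rewrite inE => /predU1P[E|//].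
have := par_least wn (rooted xn) xw; rewrite E => /containsE.
by have [? _ _] := node_bounds xn; rewrite /Defs.root /=; lia.
Qed.

Lemma top_contains w x : w \in nds -> par w = rt \/ col (par w) <> col w ->
  x \in nds -> col x = col w -> contains w x.
Proof.
move=> wn tw xn cx; have := color_in xn; rewrite cx => xc.
have [//|xw] := comparable (rooted wn) (rooted xn) (color_in wn) xc (color_node wn).
have cp := color_convex xn wn xw cx.
by case: tw => // E; have := par_nodeN wn xn xw; rewrite E (negbTE root_notin).
Qed.

(** All nodes of the color of w are below w when w is the top of its branch,
    so count_subbranch counts the whole branch. *)
Lemma top_height w : w \in nds -> par w = rt \/ col (par w) <> col w ->
  ht w = branch_size n eta (col w).
Proof.
move=> wn tw; rewrite -count_subbranch // /branch_size size_filter.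
apply: eq_in_count => x xn /=; case: eqP => //= cx; exact: top_contains.
Qed.

Lemma branch_sorted c : pairwise starts_before (branch n eta c).
Proof. exact/pairwise_filter/nodes_sorted. Qed.

Lemma branch_topP c : c \in leaves n eta ->
  [/\ branch_top n eta c \in nds, col (branch_top n eta c) = c
    & par (branch_top n eta c) = rt \/ col (par (branch_top n eta c)) <> c].
Proof.
move=> cl; rewrite /branch_top.
have cb : c \in branch n eta c by rewrite branchE leaf_color // eqxx leaf_node.
have := branch_sorted c; have memb := branchE c.
case: (branch n eta c) cb memb => // u s _ memb /= /andP[/allP us _].
have /andP[/eqP cu un] : (col u == c) && (u \in nds) by rewrite -memb mem_head.
split=> //; have := par_in un; rewrite inE => /predU1P[|pn]; first by left.
right=> cp; have : par u \in u :: s by rewrite memb cp eqxx.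
have := par_enc un; rewrite /encloses inE => pu /predU1P[E|/us]; last by lia.
by rewrite E in pu; lia.
Qed.

Lemma branch_comparable c v w : v \in branch n eta c -> w \in branch n eta c ->
  contains v w = (v.1 <= w.1).
Proof.
rewrite !branchE => /andP[/eqP cv vn] /andP[/eqP cw wn].
apply/idP/idP=> [/containsE[]//|vw].
have := color_in vn; have := color_in wn; rewrite cv cw => wc vc.
have [|//|] := comparable (rooted vn) (rooted wn) vc wc; first by rewrite -cv color_node.
by rewrite /encloses; lia.
Qed.

(** This is what turns the indices of boxes in a soliton into heights of
    nodes. *)
Lemma height_nth_branch c i : c \in leaves n eta -> i < branch_size n eta c ->
  ht (nth rt (branch n eta c) i) = branch_size n eta c - i.
Proof.
move=> cl ltic; set b := branch n eta c; set v := nth rt b i.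
have vb : v \in b by apply: mem_nth.
have /andP[/eqP cv vn] : (col v == c) && (v \in nds) by rewrite -branchE.
rewrite -count_subbranch //.
rewrite -(eq_count (a1 := predI (contains v) (fun w => col w == c))); last first.
  by move=> w /=; rewrite cv andbC.
rewrite -count_filter -/(branch n eta c) -/b.
have bs := branch_sorted c; rewrite -/b in bs.
rewrite -(cat_take_drop i b) count_cat (eq_in_count (a2 := pred0)).
  rewrite count_pred0 add0n; rewrite (eq_in_count (a2 := predT)).
    by rewrite count_predT size_drop.
  move=> w wd; have wb : w \in b by apply: mem_drop wd.
  rewrite (branch_comparable vb wb) /=; move: bs wd.
  rewrite -{1}(cat_take_drop i b) pairwise_cat.
  rewrite (drop_nth rt) // -/v /= => /and4P[_ _ /allP vs _]; rewrite inE.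
  by case/predU1P=> [->|/vs/ltnW->]; rewrite ?leqnn.
move=> w wt; have wb : w \in b by apply: mem_take wt.
rewrite (branch_comparable vb wb) /=; move: bs; rewrite -{1}(cat_take_drop i b) pairwise_cat.
rewrite (drop_nth rt) // -/v => /andP[/allrelP /(_ w v wt)]; rewrite mem_head => /(_ isT).
by rewrite ltnNge => /negbTE.
Qed.

(** * Boxes that remain after deleting nodes *)

Definition is_end (b : nat) (v : node) : bool := (b == v.1) || (b == v.2).

(** The boxes left when the nodes outside R have been deleted; the two records
    are never deleted. *)
Definition remaining (R : seq node) : seq nat :=
  [seq b <- iota 0 n.*2.+2 | [|| b == 0, b == n.*2.+1 | has (is_end b) R]].

Lemma remaining_sorted R : pairwise ltn (remaining R).
Proof.
by rewrite pairwise_filter // -sorted_pairwise ?iota_ltn_sorted //; apply: ltn_trans.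
Qed.

Lemma has_endP R b :
  reflect (exists2 v : node, v \in R & b = v.1 \/ b = v.2) (has (is_end b) R).
Proof.
apply: (iffP hasP) => -[v vR vb]; exists v => //; first by case/orP: vb => /eqP; auto.
by rewrite /is_end; case: vb => ->; rewrite eqxx ?orbT.
Qed.

Section Remaining.

Variable R : seq node.
Hypothesis subR : {subset R <= nds}.

Lemma remainingP b :
  reflect [\/ b = 0, b = n.*2.+1 | exists2 v : node, v \in R & b = v.1 \/ b = v.2]
    (b \in remaining R).
Proof.
rewrite mem_filter mem_iota /=; apply: (iffP andP).
  by case=> /or3P[/eqP->|/eqP->|/has_endP h] _; [apply: Or31|apply: Or32|apply: Or33].
have bd v : v \in R -> v.1 < n.*2.+2 /\ v.2 < n.*2.+2.
  by move=> /subR/node_bounds[]; lia.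
case=> [->|->|[v vR vb]]; rewrite ?eqxx ?orbT //.
split; last by have := bd v vR; case: vb => ->; lia.
by apply/or3P/Or33/has_endP; exists v.
Qed.

Lemma start_remaining v : v \in R -> v.1 \in remaining R.
Proof. by move=> vR; apply/remainingP/Or33; exists v; auto. Qed.

Lemma end_remaining v : v \in R -> v.2 \in remaining R.
Proof. by move=> vR; apply/remainingP/Or33; exists v; auto. Qed.

Lemma occupied_start b : b \in remaining R -> eta b -> exists2 v : node, v \in R & v.1 = b.
Proof.
move=> /remainingP hb eb; have /andP[e0 e1] := records_empty nc.
case: hb => [E|E|[v vR [E|E]]]; first by rewrite E (negbTE e0) in eb.
- by rewrite E (negbTE e1) in eb.
- by exists v.
- by have [_ _ _ _ /negP[]] := node_ends nc (subR vR); rewrite -E.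
Qed.

Lemma empty_end b : b \in remaining R -> ~~ eta b -> 0 < b < n.*2.+1 ->
  exists2 v : node, v \in R & v.2 = b.
Proof.
move=> /remainingP hb eb b0; case: hb => [||[v vR [E|E]]]; [lia|lia| |by exists v].
by have [_ _ _ /idP] := node_ends nc (subR vR); rewrite -E (negbTE eb).
Qed.

Lemma remaining_lt A B x y : remaining R = A ++ B -> x \in A -> y \in B -> x < y.
Proof.
move=> E xA yB; have := remaining_sorted R; rewrite E pairwise_cat => /andP[/allrelP h _].
exact: h.
Qed.

(** The node that opens at h cannot close before z, since nothing remains in
    between. If it closed after z, the node that closes at z would open before h,
    and the two would cross. *)
Lemma adjacent_node A B h z : remaining R = A ++ h :: z :: B ->
  eta h -> ~~ eta z -> (h, z) \in R.
Proof.
move=> E eh ez.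
have inE' b : b \in remaining R -> b <= h \/ z <= b.
  rewrite E mem_cat !inE => /or4P[bA|/eqP->|/eqP->|bB]; rewrite ?leqnn; auto.
    by left; apply: ltnW; apply: (remaining_lt E bA); rewrite mem_head.
  right; apply: ltnW; apply: (@remaining_lt (A ++ [:: h; z]) B) => //.
    by rewrite E -catA.
  by rewrite mem_cat !inE eqxx !orbT.
have hz : h < z.
  apply: (@remaining_lt (A ++ [:: h]) (z :: B)); rewrite ?mem_head //.
    by rewrite E -catA.
  by rewrite mem_cat !inE eqxx !orbT.
have hR : h \in remaining R by rewrite E mem_cat mem_head orbT.
have zR : z \in remaining R by rewrite E mem_cat !inE eqxx !orbT.
have [v vR vh] := occupied_start hR eh; have vn := subR vR.
have [v0 v12 v2n] := node_bounds vn.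
have zv : z <= v.2 by have := inE' _ (end_remaining vR); lia.
have [w wR wz] := empty_end zR ez ltac:(lia); have wn := subR wR.
have [w0 w12 w2n] := node_bounds wn.
have wh : w.1 <= h.
  by case: (inE' _ (start_remaining wR)) => //; rewrite leqNgt -wz w12.
suff vw : v.1 = w.1.
  by rewrite -vh -wz {1}vw -surjective_pairing.
have [vw|wv|//] := ltngtP v.1 w.1; first by move: vw; rewrite vh ltnNge wh.
have := node_laminar nc wn vn wv; rewrite vh wz; move: hz zv; clear; lia.
Qed.

End Remaining.

Lemma remaining_nodes : remaining nds = iota 0 n.*2.+2.
Proof.
apply/all_filterP/allP => b; rewrite mem_iota => /= hb.
have [//|b0] := eqVneq b 0; have [//|b1] := eqVneq b n.*2.+1.
by apply/has_endP; apply: (node_cover nc); lia.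
Qed.

(** Distinct nodes have distinct ends, so deleting nodes deletes exactly their
    boxes. *)
Lemma remaining_filterC R (P : pred node) : {subset R <= nds} ->
  remaining [seq v <- R | ~~ P v] =
  [seq b <- remaining R | ~~ has (is_end b) [seq v <- R | P v]].
Proof.
move=> subR; rewrite /remaining -filter_predI; apply: eq_in_filter => b.
rewrite mem_iota /= => hb.
have bd v : v \in R -> [/\ 0 < v.1, v.1 < v.2 & v.2 <= n.*2] by move=> /subR/node_bounds.
have ends v w : v \in R -> w \in R -> is_end b v -> is_end b w -> v = w.
  move=> /subR vn /subR wn /orP[]/eqP-> /orP[]/eqP.
  - exact: (node_start_inj nc).
  - by move/ends_neq => /(_ vn wn).
  - by move/esym/ends_neq => /(_ wn vn).
  - exact: node_end_inj.
have [b0|b0] := eqVneq b 0.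
  rewrite /= andbT; apply/esym/negP => /has_endP[v].
  by rewrite mem_filter => /andP[_ /bd[? ? ?]]; lia.
have [b1|b1] := eqVneq b n.*2.+1.
  rewrite /= andbT; apply/esym/negP => /has_endP[v].
  by rewrite mem_filter => /andP[_ /bd[? ? ?]]; lia.
rewrite /=; apply/hasP/andP.
  case=> v; rewrite mem_filter => /andP[Pv vR] bv; split; last by apply/hasP; exists v.
  apply/hasPn => w; rewrite mem_filter => /andP[Pw wR]; apply: contra Pv => bw.
  by rewrite (ends v w).
case=> /hasPn hP /hasP[v vR bv]; exists v => //; rewrite mem_filter vR andbT.
by apply: contraL bv => Pv; apply: hP; rewrite mem_filter Pv.
Qed.

(** Peeling off the innermost pair with adjacent_node leaves a configuration of
    the same form. *)
Lemma seam R A H T B : {subset R <= nds} -> remaining R = A ++ H ++ T ++ B ->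
  all eta H -> all (predC eta) T -> size H = size T -> {subset zip H (rev T) <= R}.
Proof.
elim: T H B R => [|z T IHT] H B R subR; first by case: H.
case/lastP: H => // H h E; rewrite all_rcons => /andP[eh eH] /= /andP[ez eT].
rewrite size_rcons => -[sz].
have E' : remaining R = (A ++ H) ++ h :: z :: (T ++ B) by rewrite E -!catA cat_rcons.
have hzR := adjacent_node subR E' eh ez.
have rem' : remaining [seq v <- R | ~~ pred1 (h, z) v] = A ++ H ++ T ++ B.
  rewrite remaining_filterC //.
  have -> : [seq b <- remaining R | ~~ has (is_end b) [seq v <- R | pred1 (h, z) v]] =
            [seq b <- remaining R | (b != h) && (b != z)].
    apply: eq_filter => b; rewrite -negb_or; congr (~~ _); apply/hasP/idP.
      by case=> v; rewrite mem_filter => /andP[/eqP-> _].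
    by move=> bv; exists (h, z); rewrite // mem_filter /= eqxx.
  have E2 : remaining R = ((A ++ H) ++ [:: h; z]) ++ (T ++ B) by rewrite E' -!catA.
  rewrite {1}E2 !filter_cat /= !eqxx /= andbF cats0 -!filter_cat -catA.
  apply/all_filterP; rewrite catA all_cat; apply/andP; split.
    apply/allP => b bA.
    have := remaining_lt E' bA (mem_head _ _).
    have : b < z by apply: (remaining_lt E' bA); rewrite !inE eqxx orbT.
    by lia.
  apply/allP => b bB.
  have : h < b by apply: (remaining_lt E2 _ bB); rewrite mem_cat !inE eqxx orbT.
  have : z < b by apply: (remaining_lt E2 _ bB); rewrite mem_cat !inE eqxx !orbT.
  by lia.
rewrite rev_cons zip_rcons ?size_rev // => v; rewrite mem_rcons inE => /predU1P[->//|vz].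
have := IHT H B _ _ rem' eH eT sz v vz; rewrite mem_filter => h'; apply/(andP (h' _)).2.
by move=> w; rewrite mem_filter => /andP[_ /subR].
Qed.

(** * Contiguous blocks are ends of branches *)

(** The nodes that are left while the set of colors that are not deleted yet is
    C. Whole branches are deleted, so this is closed under passing to a node of
    the same color. *)
Definition branches (C : seq node) : seq node := [seq v <- nds | col v \in C].

Lemma mem_branches C v : (v \in branches C) = (col v \in C) && (v \in nds).
Proof. by rewrite mem_filter. Qed.

Lemma branches_sub C : {subset branches C <= nds}.
Proof. by move=> v; rewrite mem_branches => /andP[]. Qed.

Lemma contains_bounds v w : v \in nds -> w \in nds -> v.1 <= w.1 -> w.2 <= v.2 -> contains v w.
Proof.
move=> vn wn; rewrite leq_eqVlt => /predU1P[/(node_start_inj nc vn wn)->|h1].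
  by rewrite contains_refl.
rewrite leq_eqVlt => /predU1P[/esym/(node_end_inj vn wn)->|h2]; first by rewrite contains_refl.
by rewrite /contains /encloses h1 h2 orbT.
Qed.

Section Block.

Variables (C : seq node) (A H T B : seq nat).
Hypotheses (remE : remaining (branches C) = A ++ H ++ T ++ B)
  (Heta : all eta H) (Teta : all (predC eta) T) (sizeHT : size H = size T) (H0 : H != [::]).

Let N := zip H (rev T).
Let u : node := (head 0 H, last 0 T).
Let c : node := (last 0 H, head 0 T).

Lemma block_fst : map fst N = H.
Proof. by rewrite -/unzip1 unzip1_zip // size_rev sizeHT. Qed.

Lemma block_snd : map snd N = rev T.
Proof. by rewrite -/unzip2 unzip2_zip // size_rev sizeHT. Qed.

Lemma block_sub : {subset N <= branches C}.
Proof. exact: (seam (@branches_sub C) remE). Qed.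

Lemma block_top_in : u \in N.
Proof.
rewrite /u /N; case/lastP: (T) sizeHT => [|T' z]; case: (H) H0 => //= h H' _ _.
by rewrite rev_rcons last_rcons mem_head.
Qed.

Lemma block_bottom_in : c \in N.
Proof.
rewrite /c /N; case: (T) sizeHT; case/lastP: (H) H0 => //= H' h _.
  by rewrite size_rcons.
rewrite size_rcons => z T' [sz].
by rewrite rev_cons zip_rcons ?size_rev // last_rcons mem_rcons mem_head.
Qed.

Lemma block_sorted : pairwise ltn (H ++ T).
Proof.
have := remaining_sorted (branches C); rewrite remE catA catA pairwise_cat => /and3P[_ + _].
by rewrite -catA pairwise_cat => /and3P[].
Qed.

Lemma block_start v : v \in N -> v.1 \in H.
Proof. by move=> vN; rewrite -block_fst map_f. Qed.

Lemma block_end v : v \in N -> v.2 \in T.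
Proof. by move=> vN; rewrite -mem_rev -block_snd map_f. Qed.

Lemma block_in v : v \in N -> contains u v /\ contains v c.
Proof.
move=> vN; have := block_sorted; rewrite pairwise_cat => /and3P[_ Hs Ts].
have nn x : x \in N -> x \in nds by move/block_sub/branches_sub.
by split; apply: contains_bounds; rewrite ?nn ?block_top_in ?block_bottom_in //;
  first [exact: sorted_head_leq (block_start vN) | exact: sorted_leq_last (block_end vN)
        | exact: sorted_leq_last (block_start vN) | exact: sorted_head_leq (block_end vN)].
Qed.

(** A remaining node below u opens between the first box of H and the last box
    of T, hence in H. *)
Lemma block_mem w : w \in branches C -> contains u w = (w \in N).
Proof.
move=> wR; apply/idP/idP => [uw|/block_in[]//]; have [/= w1 w2] := containsE uw.
have wn := branches_sub wR; have [_ w12 _] := node_bounds wn.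
have uH := block_start block_top_in; have uT := block_end block_top_in; rewrite /= in uH uT.
have := start_remaining (@branches_sub C) wR; rewrite remE !mem_cat => /or4P[wA|wH|wT|wB].
- have := remaining_lt remE wA; move=> /(_ (head 0 H)).
  by rewrite mem_cat uH ltnNge w1 => /(_ isT).
- move: (wH); rewrite -block_fst => /mapP[v vN E].
  by rewrite (node_start_inj nc wn (branches_sub (block_sub vN)) E).
- have [_ _ _ ew _] := node_ends nc wn.
  by have /= := allP Teta _ wT; rewrite ew.
- have E' : remaining (branches C) = (A ++ H ++ T) ++ B by rewrite remE -!catA.
  have := remaining_lt E' (x := last 0 T) _ wB.
  by rewrite !mem_cat uT !orbT => /(_ isT) /ltn_trans/(_ w12); rewrite ltnNge w2.
Qed.

(** The color of the innermost pair is a remaining leaf below it, and the only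
    remaining node below it is itself. *)
Lemma block_leaf : c \in leaves n eta /\ c \in C.
Proof.
have cN := block_bottom_in; have cR := block_sub cN; have cn := branches_sub cR.
have cl := color_leaf cn.
have colC : col c \in C by move: cR; rewrite mem_branches => /andP[].
have ccR : col c \in branches C by rewrite mem_branches (color_node cn) leaf_color // colC.
have : col c \in N.
  by rewrite -block_mem //; apply: contains_trans (color_in cn); have [] := block_in cN.
move=> /block_in[_] /contains_anti/(_ (color_in cn)) E.
by rewrite -{1}E cl -E colC.
Qed.

(** The color of v is a remaining leaf below u, so it is one of the pairs of
    the block; among them only the innermost one can be a leaf. *)
Lemma block_color v : v \in N -> col v = c.
Proof.
move=> vN; have vR := block_sub vN; have vn := branches_sub vR; have cl := color_leaf vn.
have cn : c \in nds by apply/branches_sub/block_sub/block_bottom_in.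
have colC : col v \in C by move: vR; rewrite mem_branches => /andP[].
have ccR : col v \in branches C by rewrite mem_branches (color_node vn) leaf_color // colC.
have : col v \in N.
  by rewrite -block_mem //; apply: contains_trans (color_in vn); have [] := block_in vN.
by move=> /block_in[_] /(leaf_contains cl cn).
Qed.

Lemma block_uniq : uniq N.
Proof.
apply: (@map_uniq _ _ fst); rewrite block_fst.
have := block_sorted; rewrite pairwise_cat => /and3P[_ Hs _].
exact: pairwise_uniq ltnn Hs.
Qed.

Lemma block_height : ht u = size H.
Proof.
have uN := block_top_in; have un := branches_sub (block_sub uN).
rewrite -count_subbranch // -size_filter -block_fst size_map.
apply/perm_size/uniq_perm; [by rewrite filter_uniq ?nodes_uniq | exact: block_uniq |].
move=> w; rewrite mem_filter; apply/andP/idP.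
  case=> /andP[/eqP cw uw] wn; rewrite -block_mem // mem_branches cw wn.
  by rewrite (block_color uN) andbT; case: block_leaf.
move=> wN; have wn := branches_sub (block_sub wN).
by rewrite wn !block_color // eqxx; have [] := block_in wN.
Qed.

(** A block is always a lower part of a branch; it is the whole branch as soon
    as the color changes above u. *)
Lemma block_branch : par u = rt \/ col (par u) <> c -> branch n eta c = N.
Proof.
have uN := block_top_in; have un := branches_sub (block_sub uN) => tu.
rewrite -(block_color uN) in tu.
have Ns : pairwise starts_before N.
  rewrite -(pairwise_map fst ltn) block_fst.
  by have := block_sorted; rewrite pairwise_cat => /and3P[_ Hs _].
have tr : transitive starts_before by move=> y x z; apply: ltn_trans.
apply: (irr_sorted_eq tr); rewrite ?sorted_pairwise ?branch_sorted //.
  by move=> x; rewrite /= ltnn.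
move=> w; rewrite branchE; apply/andP/idP => [[/eqP cw wn]|wN].
  rewrite -block_mem; first by apply: (top_contains un tu wn); rewrite cw (block_color uN).
  by rewrite mem_branches cw wn andbT; case: block_leaf.
by rewrite block_color // eqxx (branches_sub (block_sub wN)).
Qed.

End Block.

(** The heads of the soliton of a branch are the opening boxes of its nodes and
    its tails are the closing boxes, which are nested and so come in reverse
    order. *)
Definition soliton_of (c : node) : soliton :=
  (map fst (branch n eta c), rev (map snd (branch n eta c))).

(** The last hypothesis excludes a parent p of the outermost pair u that is in
    the same branch. *)
Lemma block_soliton C A H T B : remaining (branches C) = A ++ H ++ T ++ B ->
  all eta H -> all (predC eta) T -> size H = size T -> H != [::] ->
  (forall p u, p \in branches C -> u \in nds -> u.1 = head 0 H -> u.2 = last 0 T ->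
     ht u = size H -> par u = p -> col p = col u -> False) ->
  exists2 c : node, c \in C & (H, T) = soliton_of c.
Proof.
move=> remE eH eT sz H0 topP.
have uN := block_top_in sz H0; have uR := block_sub remE eH eT sz uN.
have [cl cC] := block_leaf remE eH eT sz H0.
exists (last 0 H, head 0 T) => //.
rewrite /soliton_of (block_branch remE eH eT sz H0).
  by rewrite block_fst // block_snd // revK.
have un := branches_sub uR; have := par_in un; rewrite inE => /predU1P[->|pn]; first by left.
right=> cp; have cu := block_color remE eH eT sz H0 uN.
apply: (topP _ _ _ un) => //; last by rewrite cp cu.
  by rewrite mem_branches cp cC.
exact: block_height remE eH eT sz H0.
Qed.

(** The nodes that close in a run of empty boxes are nested, because no
    remaining node opens between two boxes of the run. *)
Lemma zeros_height R A r B w : {subset R <= nds} -> remaining R = A ++ r ++ B ->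
  all (predC eta) r -> 0 \notin r -> n.*2.+1 \notin r -> r != [::] ->
  w \in R -> w.2 = last 0 r -> size r <= ht w.
Proof.
move=> subR; elim/last_ind: r B w => // r b IHr B w E.
rewrite all_rcons => /andP[eb er] r0 r1 _ wR.
rewrite last_rcons size_rcons => wb; have wn := subR _ wR.
have [->|rN] := eqVneq r [::]; first by rewrite height_gt0 ?rooted.
have lr : last 0 r \in r by case: (r) rN => // x s _; rewrite /= mem_last.
move: r0 r1; rewrite !mem_rcons !inE !negb_or => /andP[_ r0] /andP[_ r1].
have lR : last 0 r \in remaining R by rewrite E !mem_cat mem_rcons inE lr !orbT.
have Er : remaining R = A ++ r ++ (b :: B) by rewrite E cat_rcons.
have [||w' wR' wl] := empty_end subR lR; first exact: (allP er).
  have l1 : last 0 r != n.*2.+1 by apply: contraNneq r1 => <-.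
  rewrite lt0n ltn_neqAle l1 -ltnS; apply/andP; split.
    by apply: contraNneq r0 => <-.
  by move: lR; rewrite mem_filter mem_iota => /andP[_ /andP[]].
have wn' := subR _ wR'; have [_ w12 _] := node_bounds wn.
have Er' : remaining R = (A ++ r) ++ (b :: B) by rewrite Er catA.
have lb : last 0 r < b by apply: (remaining_lt Er'); rewrite ?mem_head // mem_cat lr orbT.
apply: leq_ltn_trans (IHr (b :: B) w' Er er r0 r1 rN wR' wl) _.
apply: (height_enc (rooted wn) wn' (enc_end (rooted wn) wn' _)); rewrite wl wb lb andbT.
have := start_remaining subR wR; rewrite Er !mem_cat => /or3P[wA|wr|].
- by apply: (remaining_lt Er wA); rewrite mem_cat lr.
- have [_ _ _ ew _] := node_ends nc wn.
  by have /= := allP er _ wr; rewrite ew.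
- rewrite inE => /predU1P[w1|wB]; first by rewrite w1 -wb ltnn in w12.
  have E3 : remaining R = (A ++ rcons r b) ++ B by rewrite E catA.
  have : b < w.1 by apply: (remaining_lt E3 _ wB); rewrite mem_cat mem_rcons mem_head orbT.
  by move=> /ltn_trans/(_ w12); rewrite wb ltnn.
Qed.

(** The mirror image of zeros_height: the nodes that open in a run of occupied
    boxes are nested. *)
Lemma ones_height R A r B w : {subset R <= nds} -> remaining R = A ++ r ++ B ->
  all eta r -> r != [::] -> w \in R -> w.1 = head 0 r -> size r <= ht w.
Proof.
move=> subR; elim: r A w => // b r IHr A w E /= /andP[eb er] _ wR wb.
have wn := subR _ wR; have [rE|rN] := eqVneq r [::]; first by rewrite rE height_gt0 ?rooted.
have hr : head 0 r \in r by case: (r) rN => // x s _; rewrite /= mem_head.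
have hR : head 0 r \in remaining R by rewrite E !mem_cat inE hr !orbT.
have Er : remaining R = (rcons A b) ++ r ++ B by rewrite E cat_rcons.
have [w' wR' wl] := occupied_start subR hR (allP er _ hr).
have wn' := subR _ wR'; have [_ w12 _] := node_bounds wn.
have bh : b < head 0 r.
  by apply: (remaining_lt Er); rewrite ?mem_cat ?hr // mem_rcons mem_head.
apply: leq_ltn_trans (IHr _ w' Er er rN wR' wl) _.
apply: (height_enc (rooted wn) wn' (enc_start (rooted wn) wn' _)); rewrite wl wb bh /=.
have := end_remaining subR wR; rewrite Er !mem_cat mem_rcons inE -orbA.
case/or4P=> [/eqP w2|wA|wr|wB].
- by rewrite w2 -wb ltnn in w12.
- have : w.2 < b by apply: (remaining_lt E wA); rewrite mem_head.
  by move=> /(ltn_trans w12); rewrite wb ltnn.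
- have [_ _ _ _ /negP[]] := node_ends nc wn; exact: (allP er).
- have E3 : remaining R = (rcons A b ++ r) ++ B by rewrite Er catA.
  by apply: (remaining_lt E3 _ wB); rewrite mem_cat hr orbT.
Qed.

(** * The soliton chosen by the head-tail rule is a branch *)

Definition color_block (r : seq nat) : bool :=
  (r != [::]) && all (fun b => eta b == eta (head 0 r)) r.

Lemma runsP s :
  [/\ flatten (runs eta s) = s, all color_block (runs eta s)
    & sorted (fun r r' => eta (head 0 r) != eta (head 0 r')) (runs eta s)].
Proof.
elim: s => //= b s [IHf IHb IHs].
case E : (runs eta s) IHf IHb IHs => [|[|c r] rs] //=.
  by move=> <- _ _; rewrite /color_block /= eqxx.
move=> <- /andP[/andP[_ /= /andP[_ cr]] brs] prs.
case: eqP => [bc|/eqP bc] /=; rewrite /color_block /= ?eqxx /=.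
  split=> //; last by case: (rs) prs => //= ? ?; rewrite bc.
  by rewrite brs andbT -bc eqxx; apply: sub_all cr => x /eqP->; rewrite bc.
by split=> //; rewrite ?bc // cr brs.
Qed.

Lemma has_smallest rs : has (finite_run n) rs -> has (smallest_run n rs) rs.
Proof.
move=> hf; pose P k := has (fun r => finite_run n r && (size r == k)) rs.
have exP : exists k, P k.
  by case/hasP: hf => r rr fr; exists (size r); apply/hasP; exists r; rewrite // fr eqxx.
case: (ex_minnP exP) => k /hasP[r rr /andP[fr /eqP <-]] kmin.
apply/hasP; exists r => //; rewrite /smallest_run fr; apply/allP => r' rr'.
by apply/implyP => fr'; apply: kmin; apply/hasP; exists r'; rewrite // fr' eqxx.
Qed.

Lemma remaining_bound R b : b \in remaining R -> b <= n.*2.+1.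
Proof. by rewrite mem_filter mem_iota => /andP[_ /andP[]]. Qed.

Lemma first_record_remaining R : 0 \in remaining R.
Proof. by rewrite mem_filter mem_iota. Qed.

Lemma last_record_remaining R : n.*2.+1 \in remaining R.
Proof. by rewrite mem_filter mem_iota eqxx orbT /= ltnS leqnn. Qed.

Lemma occupied_finite r : all eta r -> finite_run n r.
Proof.
move=> /allP er; have /andP[e0 e1] := records_empty nc.
by apply/andP; split; apply/negP => /er; apply/negP.
Qed.

(** The chosen run r is not an extreme one, since the two records are empty and
    belong to the extreme runs. It therefore has neighbors r0 and r2, of the
    opposite value. As r is the leftmost smallest run, r0 is strictly longer
    than r unless it is infinite. *)
Lemma chosen_run R (rs := runs eta (remaining R)) : 1 < size rs ->
  exists L r0 r r2 L',
  [/\ rs = L ++ [:: r0, r, r2 & L'], find (smallest_run n rs) rs = (size L).+1,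
      smallest_run n rs r, finite_run n r0 -> size r < size r0
    & [/\ remaining R = flatten L ++ r0 ++ r ++ r2 ++ flatten L',
          [/\ r0 != [::], r != [::] & r2 != [::]] &
          if eta (head 0 r) then [/\ all (predC eta) r0, all eta r & all (predC eta) r2]
          else [/\ all eta r0, all (predC eta) r & all eta r2]]].
Proof.
move=> sz; have [fl cb alt] := runsP (remaining R); rewrite -/rs in fl cb alt.
have constr r : r \in rs -> r != [::] /\
    (if eta (head 0 r) then all eta r else all (predC eta) r).
  move/(allP cb)=> /andP[-> cr]; split=> //.
  by case: ifP cr => _; apply: sub_all => b /=; case: (eta b).
have /has_smallest : has (finite_run n) rs.
  case E : rs sz alt constr => [|ra [|rb rs']] // _ /= /andP[ab _] con.
  have [_ ca] := con ra (mem_head _ _).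
  have [_ cb'] := con rb ltac:(by rewrite !inE eqxx orbT).
  apply/orP; case ea : (eta (head 0 ra)) ab ca => /= eb ca.
    by left; apply: occupied_finite.
  by right; rewrite occupied_finite //; move: cb'; case: (eta _) eb.
move=> hs; set j := find _ rs; have jlt : j < size rs by rewrite -has_find.
set r := nth [::] rs j; have sr : smallest_run n rs r := nth_find [::] hs.
have rsE : rs = take j rs ++ r :: drop j.+1 rs by rewrite -drop_nth ?cat_take_drop.
have [r0 r1] : 0 \notin r /\ n.*2.+1 \notin r by case/andP: sr => /andP.
have rrs : r \in rs by apply: mem_nth.
have [rN _] := constr r rrs.
have remE : remaining R = flatten (take j rs) ++ r ++ flatten (drop j.+1 rs).
  by rewrite -[LHS]fl {1}rsE flatten_cat.
have hr : head 0 r \in remaining R by rewrite remE !mem_cat head_in ?orbT.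
have LN : take j rs != [::].
  apply/negP => /eqP L0; have := first_record_remaining R.
  rewrite remE L0 /= mem_cat (negbTE r0) /= => h0.
  have E' : remaining R = r ++ flatten (drop j.+1 rs) by rewrite remE L0.
  by have := remaining_lt E' (head_in 0 rN) h0.
have RN : drop j.+1 rs != [::].
  apply/negP => /eqP L0; have := last_record_remaining R.
  rewrite remE L0 /= cats0 mem_cat (negbTE r1) orbF => h0.
  have := remaining_lt remE h0 (y := head 0 r); rewrite mem_cat head_in // => /(_ isT).
  by rewrite ltnNge (remaining_bound hr).
have smallL : forall r', r' \in take j rs -> finite_run n r' -> size r < size r'.
  move=> r' rL fr'; rewrite ltnNge; apply/negP => le.
  have := has_take_leq (smallest_run n rs) (ltnW jlt); rewrite -/j ltnn => /negP; apply.
  apply/hasP; exists r' => //; rewrite /smallest_run fr'; apply/allP => q qrs.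
  apply/implyP => fq; apply: leq_trans le _.
  by case/andP: sr => _ /allP/(_ q qrs); rewrite fq.
have jE : j = size (take j rs) by rewrite size_takel // ltnW.
move: rsE LN RN smallL remE jE; case/lastP: (take j rs) => // L ra.
case: (drop j.+1 rs) => // rc L' rsE _ _ smallL remE jE.
rewrite cat_rcons in rsE.
exists L, ra, r, rc, L'; split=> //; first by rewrite jE size_rcons.
  by apply: smallL; rewrite mem_rcons mem_head.
have mrs (q : seq nat) : q \in [:: ra; r; rc] -> q \in rs.
  by rewrite rsE mem_cat !inE => /or3P[]->; rewrite !orbT.
have [raN ca] := constr ra (mrs ra ltac:(by rewrite !inE eqxx)).
have [_ cr] := constr r rrs.
have [rcN cc] := constr rc (mrs rc ltac:(by rewrite !inE eqxx !orbT)).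
split=> //; first by rewrite remE flatten_rcons -!catA.
have [_ /= /and3P[]] := cat_sorted2 (etrans (congr1 _ (esym rsE)) alt).
by case: (eta (head 0 r)) cr; case: (eta (head 0 ra)) ca; case: (eta (head 0 rc)) cc.
Qed.

Lemma heir_color p v : p \in nds -> v \in nds -> par v = p -> col p = col v ->
  v = heir p /\ ht p = (ht v).+1.
Proof.
move=> pn vn pv cp; have vk : v \in kids nds p by rewrite mem_kids pv eqxx.
have k0 : kids nds p != [::] by case: (kids nds p) vk.
have E := color_kid pn vk (esym cp); split=> //.
by rewrite heir_height // -E.
Qed.

(** Suppose that the parent p of the outermost pair u of the chosen block had
    the color of u, so that u would be the heir of p and p would be one unit
    higher than u.

    If the chosen run is a one-run, the boxes of the zero-run r0 on its left
    close nested nodes inside p. There are more of them than the height of u, so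
    p would be at least two units higher than u.

    If it is a zero-run, the boxes of the one-run r2 on its right open nested
    nodes inside p, at least as many as the height of u. So p has a child to the
    right of u which is at least as high as u, and u is not its heir. *)
Lemma next_solitonP C : 1 < size (runs eta (remaining (branches C))) ->
  exists2 c : node, c \in C &
    next_soliton n eta (runs eta (remaining (branches C))) = soliton_of c.
Proof.
move=> sz; have [L [r0 [r [r2 [L' H]]]]] := chosen_run sz.
have {H} [rsE jE sr small0 [remE [r0N rN r2N] cols]] := H.
rewrite /next_soliton jE /=.
set rs := runs _ _ in rsE jE sr *.
have nth0 : nth [::] rs (size L) = r0 by rewrite rsE nth_cat ltnn subnn.
have nth1 : nth [::] rs (size L).+1 = r by rewrite rsE nth_cat ltnNge leqnSn /= subSnn.
have nth2 : nth [::] rs (size L).+2 = r2.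
  by rewrite rsE nth_cat ltnNge (leq_trans (leqnSn _) (leqnSn _)) /= !subSn // subnn.
rewrite nth0 nth1 nth2 {jE nth0 nth1 nth2}.
have smallest (q : seq nat) : q \in rs -> finite_run n q -> size r <= size q.
  by move=> qrs fq; case/andP: sr => _ /allP/(_ q qrs); rewrite fq.
have r2rs : r2 \in rs by rewrite rsE mem_cat !inE eqxx !orbT.
have r0rs : r0 \in rs by rewrite rsE mem_cat !inE eqxx !orbT.
set R := branches C in remE *; have subR : {subset R <= nds} := @branches_sub C.
have E1 : remaining R = (flatten L ++ r0) ++ r ++ r2 ++ flatten L' by rewrite remE -!catA.
have E2 : remaining R = (flatten L ++ r0 ++ r) ++ r2 ++ flatten L' by rewrite remE -!catA.
have r_rem : head 0 r \in remaining R by rewrite remE !mem_cat head_in ?orbT.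
have pos_r b : b \in r2 ++ flatten L' -> head 0 r < b.
  by apply: (remaining_lt E2); rewrite !mem_cat head_in ?orbT.
have rsort : pairwise ltn r.
  have := remaining_sorted R; rewrite E1 pairwise_cat => /and3P[_ _].
  by rewrite pairwise_cat => /and3P[].
have r2sort : pairwise ltn r2.
  have := remaining_sorted R; rewrite E2 pairwise_cat => /and3P[_ _].
  by rewrite pairwise_cat => /and3P[].
case: ifP cols => er [e0 e1 e2].
- (* If r2 contained fewer boxes than r, it would be the last run, and the
     last record would be matched with a box of r. *)
  have le2 : size r <= size r2.
    rewrite leqNgt; apply/negP => lt2.
    have nf : ~~ finite_run n r2 by apply/negP => /(smallest _ r2rs); rewrite leqNgt lt2.
    have r20 : 0 \notin r2.
      by apply/negP => h0; have := pos_r 0; rewrite mem_cat h0 => /(_ isT).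
    have r21 : n.*2.+1 \in r2 by move: nf; rewrite /finite_run r20 /= negbK.
    set H := drop (size r - size r2) r.
    have sH : size H = size r2 by rewrite size_drop subKn // ltnW.
    have HN : H != [::] by rewrite -size_eq0 sH size_eq0.
    have E3 : remaining R =
        (flatten L ++ r0 ++ take (size r - size r2) r) ++ H ++ r2 ++ flatten L'.
      by rewrite remE -!catA; congr (_ ++ (_ ++ _)); rewrite [RHS]catA /H cat_take_drop.
    have eH : all eta H by apply/allP => b /mem_drop; apply: (allP e1).
    have := seam subR E3 eH e2 sH (block_top_in sH HN) => /subR/node_bounds[_ _] /=.
    by have := sorted_leq_last r2sort r21 => /leq_trans h /h; rewrite ltnn.
  have [|||||p u pR un u1 u2 hu pu cp|c cC gE] :=
    block_soliton (C := C) (A := flatten L ++ r0) (H := r) (T := take (size r) r2)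
      (B := drop (size r) r2 ++ flatten L'); last by exists c.
  + by rewrite -/R E1; congr (_ ++ (_ ++ _)); rewrite [RHS]catA cat_take_drop.
  + exact: e1.
  + by apply/allP => b /mem_take; apply: (allP e2).
  + by rewrite size_takel.
  + exact: rN.
  have pn := subR _ pR; have [p0 _ _] := node_bounds pn.
  have pe : encloses p u by rewrite -pu par_enc.
  have [uE hp] := heir_color pn un pu cp.
  have [p1 p2] : p.1 < head 0 r /\ head 0 r < p.2.
    by move: pe; have [_ + _] := node_bounds un; rewrite -u1 /encloses; clear; lia.
  have [_ _ _ ep _] := node_ends nc pn.
  have pL : p.1 \in flatten L.
    have := start_remaining subR pR; rewrite remE !mem_cat => /or3P[//|h|].
      by have /= := allP e0 _ h; rewrite ep.
    rewrite -mem_cat => /orP[h|h].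
      by have := sorted_head_leq rsort h; rewrite leqNgt p1.
    by have := pos_r _ h; rewrite ltnNge ltnW.
  have lt0 b : b \in r0 -> p.1 < b < head 0 r.
    move=> hb; rewrite (remaining_lt remE pL) ?mem_cat ?hb //=.
    by rewrite (remaining_lt E1) // !mem_cat ?hb ?orbT // head_in.
  have f0 : 0 \notin r0 by apply/negP => /lt0.
  have f1 : n.*2.+1 \notin r0.
    by apply/negP => /lt0/andP[_]; rewrite ltnNge (remaining_bound r_rem).
  have lr0 := last_in 0 r0N; have /andP[l1 l2] := lt0 _ lr0.
  have [|||w wR wl] := empty_end subR (b := last 0 r0).
  + by rewrite remE !mem_cat lr0 !orbT.
  + exact: (allP e0).
  + rewrite (leq_ltn_trans (leq0n _) l1) /=; exact: leq_trans l2 (remaining_bound r_rem).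
  have wn := subR _ wR.
  have hw := zeros_height subR remE e0 f0 f1 r0N wR wl.
  have pw : encloses p w by apply: enc_end (rooted pn) wn _; rewrite wl l1 (ltn_trans l2).
  have := height_enc (rooted pn) wn pw; rewrite hp hu ltnS => le.
  by have := leq_trans (small0 ltac:(by apply/andP)) (leq_trans hw le); rewrite ltnn.
- have le0 := smallest _ r0rs (occupied_finite e0).
  have le2 := smallest _ r2rs (occupied_finite e2).
  set H := drop _ r0; have sH : size H = size r by rewrite size_drop subKn.
  have HN : H != [::] by rewrite -size_eq0 sH size_eq0.
  have [|||||p u pR un u1 u2 hu pu cp|c cC gE] :=
    block_soliton (C := C) (A := flatten L ++ take (size r0 - size r) r0) (H := H) (T := r)
      (B := r2 ++ flatten L'); last by exists c.
  + by rewrite -/R remE -!catA; congr (_ ++ _); rewrite [RHS]catA /H cat_take_drop.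
  + by apply/allP => b /mem_drop; apply: (allP e0).
  + exact: e1.
  + exact: sH.
  + exact: HN.
  have pn := subR _ pR.
  have pe : encloses p u by rewrite -pu par_enc.
  have [uE hp] := heir_color pn un pu cp.
  have [_ u12 _] := node_bounds un.
  have h2 := head_in 0 r2N.
  have lt2 : last 0 r < head 0 r2.
    by apply: (remaining_lt E2); rewrite !mem_cat ?h2 // last_in ?orbT.
  have [w wR w1] : exists2 w : node, w \in R & w.1 = head 0 r2.
    by apply: occupied_start => //; [rewrite remE !mem_cat h2 !orbT | apply: (allP e2)].
  have wn := subR _ wR; have [_ w12 _] := node_bounds wn.
  have hw := ones_height subR E2 e2 r2N wR w1.
  have p2 : head 0 r2 < p.2.
    have lp : last 0 r < p.2 by rewrite -u2; case/andP: pe.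
    have [_ _ _ _ ep] := node_ends nc pn.
    have := end_remaining subR pR; rewrite E1 !mem_cat -mem_cat => /or4P[h|h|h|h].
    + have := remaining_lt E1 h (y := last 0 r); rewrite mem_cat last_in // => /(_ isT).
      by rewrite ltnNge ltnW.
    + by have := sorted_leq_last rsort h; rewrite leqNgt lp.
    + by have := allP e2 _ h; rewrite (negbTE ep).
    + have E3 : remaining R = (flatten L ++ r0 ++ r ++ r2) ++ flatten L' by rewrite remE -!catA.
      by apply: (remaining_lt E3 _ h); rewrite !mem_cat h2 !orbT.
  have pw : encloses p w.
    apply: enc_start (rooted pn) wn _; rewrite w1 p2 andbT; apply: ltn_trans lt2.
    by rewrite -u2; apply: ltn_trans u12; case/andP: pe.
  (* The child q of p that contains w is higher than or as high as u, so by
     the choice of the heir u it opens before u; but it closes after u. *)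
  have [q qk qw] := child_containing upward_nodes (rooted pn) wn pw.
  have qn := kid_node qk; have [q1 q2] := containsE qw.
  have k0 : kids nds p != [::] by case: (kids nds p) qk.
  have [_ _ /(_ q qk) []] := heirP (rooted pn) k0; rewrite -uE => hq1 hq2.
  have hwq : ht w <= ht q by case/predU1P: qw => [->//|/(height_enc (rooted qn) wn)/ltnW].
  have qu : q.1 <= u.1.
    by apply: hq2; apply/eqP; rewrite eqn_leq hq1 hu sH (leq_trans le2 (leq_trans hw hwq)).
  have := siblings qn un; move: qk; rewrite mem_kids => /andP[/eqP-> _].
  have [E|ne] := eqVneq q.1 u.1.
    have E' := node_start_inj nc qn un E.
    by move: q2 w12; rewrite E' u2 w1 => q2 /(ltn_trans lt2)/leq_trans/(_ q2); rewrite ltnn.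
  rewrite pu ltn_neqAle ne qu => /(_ erefl isT); rewrite ltnNge => /negP; apply.
  apply: ltnW; apply: leq_trans q2; apply: ltn_trans w12; rewrite w1.
  by apply: ltn_trans lt2; rewrite -u2.
Qed.

(** * The solitons are the branches *)

Lemma soliton_boxesE c b :
  (b \in soliton_boxes (soliton_of c)) = has (is_end b) (branch n eta c).
Proof.
rewrite mem_cat mem_rev; apply/orP/has_endP.
  by case=> /mapP[v vb ->]; exists v; auto.
by case=> v vb [->|->]; [left|right]; rewrite map_f.
Qed.

Lemma remaining_branches_rem C c : uniq C -> c \in C ->
  [seq b <- remaining (branches C) | b \notin soliton_boxes (soliton_of c)] =
  remaining (branches (rem c C)).
Proof.
move=> uC cC.
have -> : branches (rem c C) = [seq v <- branches C | ~~ (col v == c)].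
  by rewrite /branches -filter_predI; apply: eq_in_filter => v _; rewrite /= mem_rem_uniq ?inE.
rewrite remaining_filterC; last exact: branches_sub.
apply: eq_filter => b; rewrite soliton_boxesE; congr (~~ has _ _).
rewrite /branch /branches -filter_predI; apply: eq_in_filter => v _ /=.
by case: eqP => // ->; rewrite cC.
Qed.

Lemma runs_branches_nil C : {subset C <= leaves n eta} ->
  size (runs eta (remaining (branches C))) <= 1 -> C = [::].
Proof.
case: C => // c C sub; set R := branches _ => sz; exfalso.
have cl : c \in leaves n eta by apply: sub; rewrite mem_head.
have cR : c \in R by rewrite mem_branches leaf_color // mem_head leaf_node.
have c1 := start_remaining (@branches_sub _) cR; have c0 := first_record_remaining R.
have [_ _ _ ec _] := node_ends nc (leaf_node cl).
have /andP[e0 _] := records_empty nc.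
have [fl cb _] := runsP (remaining R); rewrite -/R -fl in c1 c0.
case: (runs eta (remaining R)) sz c1 c0 cb => [|r [|]] //= _.
rewrite cats0 andbT => c1 c0 /andP[_ /allP cr].
by have := cr _ c0; rewrite -(eqP (cr _ c1)) ec (negbTE e0).
Qed.

Lemma HT_recS f s : HT_rec n eta f.+1 s =
  if size (runs eta s) <= 1 then [::] else
  let g := next_soliton n eta (runs eta s) in
  g :: HT_rec n eta f [seq b <- s | b \notin soliton_boxes g].
Proof. by []. Qed.

(** Each round deletes one branch and keeps the others whole, so the rounds
    can be followed by induction on the number of branches that are left. *)
Lemma HT_rec_perm f C : uniq C -> {subset C <= leaves n eta} -> size C <= f ->
  perm_eq (HT_rec n eta f (remaining (branches C))) (map soliton_of C).
Proof.
elim: f C => [|f IHf] C uC sub; first by case: C uC sub.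
move=> szC; rewrite HT_recS; case: leqP => sz; first by rewrite (runs_branches_nil sub sz).
have [c cC gE] := next_solitonP sz; rewrite gE; lazy zeta; rewrite remaining_branches_rem //.
rewrite perm_sym; apply: perm_trans (perm_map soliton_of (perm_to_rem cC)) _.
rewrite map_cons perm_cons perm_sym; apply: IHf; rewrite ?rem_uniq //.
  by move=> x /mem_rem/sub.
by rewrite size_rem //; case: (C) cC szC.
Qed.

Lemma leaves_uniq : uniq (leaves n eta).
Proof. by rewrite filter_uniq ?nodes_uniq. Qed.

Lemma branches_leaves : branches (leaves n eta) = nds.
Proof. by apply/all_filterP/allP => v; apply: color_leaf. Qed.

(** The nodes have twice as many ends as there are nodes, all different and
    all in [1, 2n]: this is why n rounds are enough. *)
Lemma size_nodes : size nds <= n.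
Proof.
have : size (map fst nds ++ map snd nds) <= size (iota 1 n.*2).
  apply: uniq_leq_size.
    rewrite cat_uniq !map_inj_in_uniq ?nodes_uniq ?andbT //=; last 2 first.
    - by move=> v w; apply: node_end_inj.
    - by move=> v w; apply: (node_start_inj nc).
    apply/hasPn => _ /mapP[v vn ->]; apply/mapP => -[w wn] /esym; exact: ends_neq.
  move=> b; rewrite mem_cat mem_iota => /orP[] /mapP[v /node_bounds[? ? ?] ->]; lia.
by rewrite size_cat !size_map size_iota addnn leq_double.
Qed.

Lemma HT_solitons_perm : perm_eq (HT_solitons n eta) (map soliton_of (leaves n eta)).
Proof.
rewrite /HT_solitons -remaining_nodes -branches_leaves; apply: HT_rec_perm => //.
  exact: leaves_uniq.
apply: leq_trans size_nodes; rewrite uniq_leq_size ?leaves_uniq //.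
exact: leaf_node.
Qed.

(** * Slots *)

Local Notation bsize := (branch_size n eta).
Local Notation pruned := (pruned n eta).

Lemma mem_pruned k v : (v \in pruned k) = (k < bsize (col v)) && (v \in nds).
Proof. by rewrite mem_filter. Qed.

Lemma tall_pruned k v : v \in nds -> k < ht v -> v \in pruned k.
Proof. by move=> vn kv; rewrite mem_pruned vn (leq_trans kv) // height_le_branch. Qed.

(** When w and its parent have different colors, w is the top of its branch, so
    the size of this branch is the height of w, which is less than the height of
    the parent and hence than the size of the branch of the parent. *)
Lemma upward_pruned k : upward (pruned k).
Proof.
move=> w; rewrite mem_pruned => /andP[kw wn]; split=> //.
have := par_in wn; rewrite !inE => /predU1P[->|pn]; first by rewrite eqxx.
apply/orP; right; have [cp|/eqP cp] := eqVneq (col (par w)) (col w).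
  by rewrite mem_pruned cp kw.
apply: tall_pruned => //; apply: ltn_trans (height_par wn).
by rewrite top_height //; right.
Qed.
Hint Resolve upward_pruned : core.

Lemma heir_pruned k v : v \in pruned k -> kids nds v != [::] -> heir v \in kids (pruned k) v.
Proof.
rewrite mem_pruned => /andP[kv vn] k0; have := heir_kid vn k0.
by rewrite !mem_kids mem_pruned color_heir // kv => /andP[-> ->].
Qed.

Lemma pruned_kids k v : {subset kids (pruned k) v <= kids nds v}.
Proof. by move=> w; rewrite !mem_kids mem_pruned => /and3P[-> _ ->]. Qed.

(** A child that is the top of its branch is as high as its branch is long,
    which is more than k in the pruned tree. *)
Lemma pruned_kidP k v w : v \in rt :: nds -> w \in kids (pruned k) v ->
  k < ht w \/ [/\ v \in nds, w = heir v & ht v = (ht w).+1].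
Proof.
move=> vn wk; have := pruned_kids wk; rewrite mem_kids => /andP[/eqP pw wn].
move: (wk); rewrite mem_kids mem_pruned => /and3P[_ kw _].
have [cw|/eqP cw] := eqVneq (col v) (col w); last by left; rewrite top_height // pw; right.
move: (vn); rewrite inE => /predU1P[E|vn'].
  by left; rewrite top_height //; left; rewrite pw.
by right; have [-> ->] := heir_color vn' wn pw cw.
Qed.

(** Pruning never removes the heir of a node that is kept. *)
Lemma height_pruned k v : v \in pruned k -> height n eta (pruned k) v = ht v.
Proof.
move=> vk; have [m] := ubnP (ht v); elim: m v vk => // m IHm v vk lt.
have /andP[_ vn] : (k < bsize (col v)) && (v \in nds) by rewrite -mem_pruned.
have V := rooted vn; rewrite heightE //.
rewrite (eq_big_seq (fun w => ht w)) => [|w wk]; last first.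
  apply: IHm; first by move: wk; rewrite mem_kids => /andP[].
  exact: leq_trans (height_kid V (pruned_kids wk)) lt.
have [k0|k0] := eqVneq (kids nds v) [::].
  rewrite [RHS]heightE // k0 big_nil; congr _.+1.
  by apply: big1_seq => w /= /pruned_kids; rewrite k0.
rewrite heir_height //; congr _.+1; apply/eqP; rewrite eqn_leq; apply/andP; split.
  apply/bigmax_leqP_seq => w /pruned_kids wk _.
  by have [_ _ /(_ w wk) []] := heirP V k0.
exact: leq_bigmax_seq (heir_pruned vk k0) _.
Qed.

Lemma path_to_leaf_pruned k v : v \in pruned k ->
  path_to_leaf n eta (pruned k) (ht v) v.
Proof.
move=> vk; have /andP[_ vn] : (k < bsize (col v)) && (v \in nds) by rewrite -mem_pruned.
move: v vn vk; apply: heir_ind => v vn k0.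
  rewrite heightE ?rooted // k0 big_nil /= => _; case E : (kids _ v) => [|w s] //.
  have : w \in kids nds v by apply: (@pruned_kids k); rewrite E mem_head.
  by rewrite k0.
move=> IH vk; have hk := heir_pruned vk k0; rewrite heir_height //.
have := IH ltac:(by move: hk; rewrite mem_kids => /andP[]).
have := height_gt0 (rooted (heir_node vn k0)); case: (ht _) => // m _ hm.
by apply/hasP; exists (heir v).
Qed.

(** The box just before an arc: going around the tree, the arc begins when the
    node v opens or when its child number q closes. *)
Definition arc_box (ns : seq node) (s : Defs.arc) : nat :=
  let: (v, p) := s in if p is q.+1 then (nth rt (kids ns v) q).2 else v.1.

Lemma contour_boxes f ns v :
  map (arc_box ns) (contour_rec n eta f.+1 ns v) =
  v.1 :: flatten [seq rcons (map (arc_box ns) (contour_rec n eta f ns w)) w.2 | w <- kids ns v].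
Proof.
rewrite /= map_flatten -map_comp; congr (_ :: flatten _).
rewrite -[in RHS](take_size (kids ns v)) -(map_nth_iota0 rt (leqnn _)) -map_comp.
by apply: eq_map => q; rewrite /= map_rcons.
Qed.

Lemma kids_sorted ns v : pairwise starts_before ns ->
  pairwise starts_before (kids ns v).
Proof. exact: pairwise_filter. Qed.

Lemma pruned_sorted k : pairwise starts_before (pruned k).
Proof. exact/pairwise_filter/nodes_sorted. Qed.

Lemma pruned_kids_sorted k v : pairwise starts_before (kids (pruned k) v).
Proof. exact/kids_sorted/pruned_sorted. Qed.

(** The contour below a child stays between the two ends of this child, and
    different children are disjoint. *)
Lemma contour_sorted k f v : v \in rt :: nds -> v.2 - v.1 < f.*2 -> v.1 < v.2 ->
  let l := map (arc_box (pruned k)) (contour_rec n eta f (pruned k) v) in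
  pairwise ltn l /\ {in l, forall b, v.1 <= b < v.2}.
Proof.
elim: f v => // f IHf v vn lt v12; rewrite contour_boxes.
set F := fun w => rcons _ _; set ws := kids _ v.
have hw w : w \in ws -> [/\ v.1 < w.1, w.2 < v.2 & pairwise ltn (F w) /\
    {in F w, forall b, w.1 <= b <= w.2}].
  move=> wk; have wn := kid_node (pruned_kids wk); have [_ w12 _] := node_bounds wn.
  have /andP[h1 h2] := kid_enc (@upward_pruned k) wk; split=> //.
  have [||sF bF] := IHf w (rooted wn); [by move: h1 h2 lt w12; clear; lia | by [] |].
  split; first by rewrite pairwise_rcons sF andbT; apply/allP => b /bF/andP[].
  move=> b; rewrite mem_rcons inE => /predU1P[->|/bF/andP[-> /ltnW->]] //.
  by rewrite leqnn ltnW.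
have mem_in b : b \in flatten (map F ws) -> v.1 < b < v.2.
  case/flatten_mapP=> w /hw[h1 h2 [_ bF]] /bF/andP[h3 h4].
  by rewrite (leq_trans h1 h3) (leq_ltn_trans h4 h2).
split=> [|b]; last first.
  by rewrite inE => /predU1P[->|/mem_in/andP[/ltnW-> ->]] //; rewrite leqnn.
rewrite /=; apply/andP; split; first by apply/allP => b /mem_in/andP[].
apply: flatten_sorted => [w /hw[]//|].
apply: (@sub_in_pairwise _ (mem ws)) (pruned_kids_sorted k v); last by apply/allP.
move=> w w' /= /pruned_kids; rewrite mem_kids => /andP[/eqP pw wn].
move=> /pruned_kids; rewrite mem_kids => /andP[/eqP pw' wn'].
by apply: siblings => //; rewrite pw pw'.
Qed.

Lemma contour_arc ns f v s : s \in contour_rec n eta f ns v ->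
  s.1 \in v :: ns /\ s.2 <= size (kids ns s.1).
Proof.
elim: f v => // f IHf v; rewrite /= inE => /predU1P[->|]; first by rewrite mem_head.
case/flatten_mapP=> q; rewrite mem_iota => /= qs; rewrite mem_rcons inE.
case/predU1P=> [->|/IHf]; first by rewrite mem_head.
rewrite !inE => -[h1 h2]; split=> //; case/predU1P: h1 => [->|->]; rewrite ?orbT //.
have : nth rt (kids ns v) q \in kids ns v by apply: mem_nth.
by rewrite mem_kids => /andP[_ ->]; rewrite orbT.
Qed.

Lemma arc_contour ns f v w (p : nat) : upward ns -> v \in rt :: nds -> v.2 - v.1 < f.*2 ->
  w \in v :: ns -> contains v w -> p <= size (kids ns w) ->
  (w, p) \in contour_rec n eta f ns v.
Proof.
move=> up; elim: f v => // f IHf v vn lt wv cvw ps; rewrite inE.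
move: wv cvw ps; have [->|wN] := eqVneq w v => wv cvw ps.
  case: p ps {IHf} => [|q] qs; first by rewrite eqxx.
  apply/orP; right; apply/flatten_mapP; exists q; first by rewrite mem_iota.
  by rewrite mem_rcons mem_head.
apply/orP; right; move: wv cvw; rewrite inE (negbTE wN) /= => wns.
rewrite /contains eq_sym (negbTE wN) /= => vw.
have [q qk qw] := child_containing up vn wns vw.
have qi : index q (kids ns v) < size (kids ns v) by rewrite index_mem.
apply/flatten_mapP; exists (index q (kids ns v)); first by rewrite mem_iota.
rewrite mem_rcons inE; apply/orP; right; rewrite nth_index //.
have qns : q \in ns by move: qk; rewrite mem_kids => /andP[].
have [qn _] := up _ qns; have [_ q12 _] := node_bounds qn.
apply: IHf; rewrite ?rooted ?inE ?wns ?orbT //.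
by have /andP[] := kid_enc up qk; move: lt q12; clear; lia.
Qed.

(** The common description of the k-slots of both decompositions. *)
Definition tall_end (k b : nat) : Prop :=
  b = 0 \/ exists2 v : node, v \in nds & k < ht v /\ (b = v.1 \/ b = v.2).

(** Node number l of an m-branch, counted from 1 at its top, has height m - l + 1.
    So l <= m - k says that this height is larger than k, and the boxes h_l and
    t_(m-l+1) are the two ends of that same node. *)
Lemma HT_slotP k b : reflect (tall_end k b) (HT_slot n eta k b).
Proof.
have sz c : soliton_size (soliton_of c) = bsize c by rewrite /soliton_size size_map.
apply: (iffP orP); case=> [/eqP|]; try by left; auto.
  case/hasP=> g; rewrite (perm_mem HT_solitons_perm) => /mapP[c cl ->].
  rewrite sz => /andP[kc /hasP[l]]; rewrite mem_iota => /andP[l0 lk].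
  have lm : l.-1 < bsize c by move: l0 lk kc; clear; lia.
  move=> hb; right; exists (nth rt (branch n eta c) l.-1).
    by have := mem_nth rt lm; rewrite branchE => /andP[].
  split; first by rewrite height_nth_branch //; move: l0 lk kc; clear; lia.
  case/orP: hb => /eqP->; [left; rewrite /soliton_h (nth_map rt) //|right].
  rewrite /soliton_t /= nth_rev size_map -/(bsize c); last by move: l0 lk kc; clear; lia.
  have -> : bsize c - (bsize c - l).+1 = l.-1 by move: l0 lk kc; clear; lia.
  by rewrite (nth_map rt).
case=> v vn [kv bv]; right; have cl := color_leaf vn; set c := col v in cl.
apply/hasP; exists (soliton_of c); first by rewrite (perm_mem HT_solitons_perm) map_f.
have vb : v \in branch n eta c by rewrite branchE eqxx.
pose i := index v (branch n eta c); have im : i < bsize c by rewrite /branch_size index_mem.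
have vE : nth rt (branch n eta c) i = v by rewrite nth_index.
have hv := height_nth_branch cl im; rewrite vE in hv.
rewrite sz hv in kv *; apply/andP; split; first by apply: leq_trans kv (leq_subr _ _).
apply/hasP; exists i.+1; first by rewrite mem_iota; move: kv im; clear; lia.
rewrite /soliton_h /soliton_t /= nth_rev size_map -/(bsize c); last by move: im; clear; lia.
have -> : bsize c - (bsize c - i.+1).+1 = i by move: im; clear; lia.
by rewrite !(nth_map rt) // vE; case: bv => ->; rewrite eqxx ?orbT.
Qed.

Lemma tall_end_bound k b : tall_end k b -> b < n.*2.+1.
Proof. by case=> [->|[v /node_bounds[_ ? ?] [_ [->|->]]]]; lia. Qed.

Lemma mem_contour k v (p : nat) : v \in rt :: pruned k -> p <= size (kids (pruned k) v) ->
  (v, p) \in contour n eta (pruned k).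
Proof.
move=> vr ps; apply: arc_contour => //; first exact: mem_head.
move: vr; rewrite inE mem_pruned => /predU1P[->|/andP[_ vn]]; first exact: contains_refl.
by rewrite /contains root_enc ?orbT.
Qed.

Lemma contour_boxes_sorted k :
  pairwise ltn (map (arc_box (pruned k)) (contour n eta (pruned k))).
Proof.
by have [|//|cs _] := @contour_sorted k n.+1 rt (mem_head _ _); first by rewrite /=; clear; lia.
Qed.

(** Both sides are increasing, so it is enough to compare their elements. The
    delicate arcs are those of a node v of height k + 1: its only child in the
    pruned tree is its heir, which starts a path of k nodes, so that only the
    first arc of v is a slot; and the box that closes the heir is not counted,
    as the height of the heir is k. All other arcs that are slots have a child
    of height larger than k on their left, if any. *)
Lemma tree_slots_boxes k : 0 < k ->
  map (arc_box (pruned k)) (tree_slots n eta k) = HT_slots n eta k.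
Proof.
move=> k0; have rtV : rt \in rt :: nds by rewrite mem_head.
apply: (irr_sorted_eq ltn_trans ltnn).
- apply: pairwise_sorted; move: (contour_boxes_sorted k); rewrite !pairwise_map.
  exact: pairwise_filter.
- by apply: sorted_filter (iota_ltn_sorted _ _); apply: ltn_trans.
move=> b; rewrite mem_filter mem_iota /=; apply/mapP/andP.
  case=> -[v p]; rewrite mem_filter => /andP[sl ct] ->; have [/= vp ps] := contour_arc ct.
  suff : tall_end k (arc_box (pruned k) (v, p)).
    move=> te; split; first exact/HT_slotP.
    exact: tall_end_bound te.
  have vV : v \in rt :: nds.
    by move: vp; rewrite !inE mem_pruned => /predU1P[->|/andP[_ ->]]; rewrite ?eqxx ?orbT.
  move: sl; rewrite /tree_slot; case: eqP => [vr _|vr] /=.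
    case: p ps ct => [|q] qs _ /=; first by left; rewrite vr.
    have wk := mem_nth rt qs; set w := nth _ _ _ in wk *; right; exists w.
      exact: kid_node (pruned_kids wk).
    split; last by right.
    case: (pruned_kidP vV wk) => // -[vn _ _].
    by rewrite vr (negbTE root_notin) in vn.
  have vp' : v \in pruned k by move: vp; rewrite inE; case: eqP.
  rewrite height_pruned //.
  case: p ps ct => [|q] qs _ /= sl.
    right; exists v; first by move: vp'; rewrite mem_pruned => /andP[].
    split; last by left.
    by case/orP: sl => [/ltnW//|/andP[/eqP->]].
  have wk := mem_nth rt qs; set w := nth _ _ _ in wk *; right; exists w.
    exact: kid_node (pruned_kids wk).
  split; last by right.
  case: (pruned_kidP vV wk) => // -[vn wE hw]; case/orP: sl => [|/andP[/eqP hv /allP hq]].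
    by rewrite hw ltnS.
  have wp : w \in pruned k by move: wk; rewrite mem_kids => /andP[].
  have := hq q; rewrite mem_iota => /(_ qs) /implyP; rewrite -/w ltnn => hN.
  have := path_to_leaf_pruned wp; rewrite (_ : ht w = k) => [/hN//|].
  by apply/eqP; rewrite -eqSS -hw hv.
case=> /HT_slotP te _.
case: te => [->|[v vn [kv [->|->]]]].
- exists (rt, 0) => //; rewrite mem_filter /= eqxx /=.
  by apply: mem_contour => //; exact: mem_head.
- have vp := tall_pruned vn kv; exists (v, 0) => //.
  rewrite mem_filter mem_contour ?inE ?vp ?orbT //.
  rewrite andbT /= height_pruned //; apply/or3P.
  move: kv; rewrite leq_eqVlt => /predU1P[E|lt]; last exact: Or32.
  by apply: Or33; rewrite -E eqxx /=; apply/allP => q _; apply: implybT.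
have vp := tall_pruned vn kv; have [_ pp] := upward_pruned vp.
have vk : v \in kids (pruned k) (par v) by rewrite mem_kids eqxx.
exists (par v, (index v (kids (pruned k) (par v))).+1); last by rewrite /= nth_index.
rewrite mem_filter mem_contour ?index_mem // andbT /=.
move: pp; rewrite inE => /predU1P[->|pp]; first by rewrite eqxx.
apply/or3P/Or32; rewrite height_pruned //.
exact: leq_trans (height_par vn).
Qed.

(** * Attachment to slots *)

Section Attachment.

Variables (k : nat) (c : node).
Hypotheses (k0 : 0 < k) (cl : c \in leaves n eta) (ck : bsize c = k).

Let u := branch_top n eta c.
Let v := par u.
Let left := [seq x <- kids (pruned k) v | x.1 < u.1].

Lemma top_node : u \in nds. Proof. by have [] := branch_topP cl. Qed.

Lemma top_color : col u = c. Proof. by have [] := branch_topP cl. Qed.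

Lemma top_max : par u = rt \/ col (par u) <> col u.
Proof. by have [_ -> h] := branch_topP cl. Qed.

Lemma top_size : ht u = k.
Proof. by rewrite (top_height top_node top_max) top_color. Qed.

Lemma left_prefix : left = take (size left) (kids (pruned k) v).
Proof. by rewrite {1}/left filter_prefix ?pruned_kids_sorted // size_filter. Qed.

Lemma tree_attachedE s : tree_attached n eta k s c = (s == (v, size left)).
Proof.
case: s => v' p; rewrite /tree_attached -/u mem_kids xpair_eqE [v' == v]eq_sym -/v.
have up : u \in pruned k.-1 by rewrite mem_pruned top_color ck top_node prednK // leqnn.
rewrite up andbT; case: eqP => //= <-; rewrite eq_sym; congr (_ == _).
rewrite take_index_prefix ?pruned_kids_sorted //; last by rewrite mem_kids eqxx.
rewrite -[LHS]size_filter (eq_in_filter (a2 := fun x => k < bsize (col x))); last first.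
  move=> x; rewrite !mem_filter => /andP[_ /and3P[_ _ xn]].
  by rewrite /= mem_pruned mem_filter xn andbT.
rewrite /left /children /Defs.pruned; move: (nodes n eta) => N.
rewrite -!filter_predI; congr size; apply: eq_filter => x /=.
have [kx|] := ltnP k (bsize (col x)); last by rewrite !andbF.
by rewrite (leq_ltn_trans (leq_pred _) kx) !andbT.
Qed.

Let b0 := arc_box (pruned k) (v, size left).

(** The branch of u is attached to the arc of its parent v that follows the
    children of v in the pruned tree located to the left of u. When there is such
    a child, the last one, y, is higher than k: otherwise y would be the heir of
    v, of height k, although u is another child of height k to the right of it.
    When there is none, the arc begins where v opens, and v is the root or is
    higher than u. *)
Lemma attach_boxP : [/\ v.1 <= b0, b0 < u.1, tall_end k b0
  & {in kids (pruned k) v, forall q, q.1 < u.1 -> q.2 <= b0}].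
Proof.
have un := top_node; have vV : v \in rt :: nds by rewrite par_in.
have vu : encloses v u := par_enc un; have /andP[vu1 vu2] := vu.
have memleft x : (x \in left) = (x.1 < u.1) && (x \in kids (pruned k) v) by rewrite mem_filter.
rewrite /b0 /=; case E : (size left) => [|m].
  split=> //.
    have := vV; rewrite inE => /predU1P[->|vn]; first by left.
    by right; exists v => //; split; [rewrite -top_size height_par | left].
  move=> q qk qu; have : q \in left by rewrite memleft qu.
  by rewrite (size0nil E).
set y := nth _ _ _; have yE : y = last rt left.
  by rewrite -nth_last E /= left_prefix nth_take // E.
have yl : y \in left by rewrite yE -nth_last mem_nth // E.
move: (yl); rewrite memleft => /andP[yu yk].
have ykn := pruned_kids yk; have yn := kid_node ykn.
have [_ y12 _] := node_bounds yn; have /andP[vy1 vy2] := kid_enc upward_nodes ykn.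
have yv : par y = v by move: yk; rewrite mem_kids => /andP[/eqP].
split.
- exact: ltnW (ltn_trans vy1 y12).
- exact: siblings yn un yv yu.
- right; exists y => //; split; last by right.
  case: (pruned_kidP vV yk) => // -[vn yh hy].
  have uk : u \in kids nds v by rewrite mem_kids eqxx.
  have kN : kids nds v != [::] by case: (kids nds v) uk.
  have [_ _ /(_ u uk)] := heirP vV kN; rewrite -yh top_size => -[ky eqy].
  rewrite ltn_neqAle ky andbT; apply/eqP => /eqy; by rewrite leqNgt yu.
- move=> q qk qu; have ql : q \in left by rewrite memleft qu.
  have ls : pairwise starts_before left.
    exact/pairwise_filter/pruned_kids_sorted.
  have [->|lt] := last_pairwise rt ls ql; first by rewrite -yE.
  have qkn := pruned_kids qk; rewrite -yE in lt.
  apply: ltnW; apply: ltn_trans y12; apply: siblings => //; first exact: kid_node qkn.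
  by rewrite yv; move: qk; rewrite mem_kids => /andP[/eqP].
Qed.

(** No tall end is inside u, which has height k. So the arc to which the branch
    is attached begins at the last tall end before u. *)
Lemma attach_box_max b : tall_end k b -> b <= b0 \/ u.2 < b.
Proof.
have un := top_node; have vV : v \in rt :: nds by rewrite par_in.
have vu : encloses v u := par_enc un; have /andP[vu1 vu2] := vu.
have [vb bu _ leftb] := attach_boxP.
case=> [->|[w wn [kw bw]]]; first by left.
have [_ w12 _] := node_bounds wn; have [_ u12 _] := node_bounds un.
have [wu|uw|E] := ltngtP w.1 u.1.
- have [wu'|wu'] := laminar (rooted wn) un wu; last first.
    have /containsE[h1 h2] := par_least un (rooted wn) wu'.
    case: bw => ->; [left; exact: leq_trans vb | right; exact: leq_trans vu2 _].
  left; apply: (@leq_trans w.2); first by case: bw => ->; rewrite // ltnW.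
  have [wv|vw] := leqP w.2 v.1; first exact: leq_trans vb.
  have vw' : encloses v w.
    by apply: enc_end => //; rewrite vw (ltn_trans wu') // (ltn_trans u12).
  have [q qk qw] := child_containing upward_nodes vV wn vw'.
  have qn := kid_node qk; have [q1 q2] := containsE qw; apply: leq_trans q2 _.
  apply: leftb; last exact: leq_ltn_trans wu.
  have kq : k < ht q.
    by case/predU1P: qw => [->//|/(height_enc (rooted qn) wn)]; apply: ltn_trans.
  by move: qk; rewrite !mem_kids tall_pruned // => /andP[->].
- have [uw'|uw'] := laminar (rooted un) wn uw.
    by right; case: bw => ->; rewrite // (ltn_trans uw').
  by have := height_enc (rooted un) wn uw'; rewrite top_size ltnNge (ltnW kw).
- by move: kw; rewrite (node_start_inj nc wn un E) top_size ltnn.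
Qed.

Lemma soliton_span b : b \in soliton_boxes (soliton_of c) -> u.1 <= b <= u.2.
Proof.
rewrite soliton_boxesE => /has_endP[w]; rewrite branchE => /andP[/eqP cw wn].
have [_ w12 _] := node_bounds wn.
have /containsE[h1 h2] := top_contains top_node top_max wn ltac:(by rewrite cw top_color).
case=> ->; first by rewrite h1 (leq_trans (ltnW w12)).
by rewrite h2 (leq_trans h1) // ltnW.
Qed.

Lemma top_box : u.1 \in soliton_boxes (soliton_of c).
Proof.
rewrite soliton_boxesE; apply/has_endP; exists u; last by left.
by rewrite branchE top_color eqxx top_node.
Qed.

(** The boxes of the soliton are between two consecutive slots exactly when the
    first of these slots is the last tall end before u. Since the boxes of arcs
    are distinct, this identifies the arc. *)
Lemma attachedE i : i < size (tree_slots n eta k) ->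
  HT_attached n eta k i (soliton_of c) =
  tree_attached n eta k (nth (rt, 0) (tree_slots n eta k) i) c.
Proof.
move=> lti; rewrite tree_attachedE; set s := nth _ _ i.
have [_ bu tb _] := attach_boxP; have un := top_node; have [_ u12 u2n] := node_bounds un.
set L := HT_slots n eta k; have LE : L = map (arc_box (pruned k)) (tree_slots n eta k).
  by rewrite tree_slots_boxes.
have sL : i < size L by rewrite LE size_map.
have Li : nth n.*2.+1 L i = arc_box (pruned k) s by rewrite LE (nth_map (rt, 0)).
have Lsort : sorted ltn L by apply: sorted_filter (iota_ltn_sorted _ _); apply: ltn_trans.
have memL b : b \in L -> tall_end k b by rewrite mem_filter => /andP[/HT_slotP].
have b0L : b0 \in L.
  by rewrite mem_filter mem_iota /= add0n (tall_end_bound tb) andbT; apply/HT_slotP.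
have -> : (s == (v, size left)) = (nth n.*2.+1 L i == b0).
  rewrite Li; apply/eqP/eqP => [->//|]; apply: map_uniq_inj.
  - exact: pairwise_uniq ltnn (contour_boxes_sorted k).
  - by have := mem_nth (rt, 0) lti; rewrite mem_filter => /andP[].
  - apply: mem_contour; last by rewrite size_filter count_size.
    have := par_in un; rewrite -/v !inE => /predU1P[->|vn]; first by rewrite eqxx.
    by rewrite tall_pruned ?orbT // -top_size height_par.
apply/allP/eqP => [h|E b /soliton_span/andP[ub bu2]].
  have /andP[h1 h2] := h _ top_box.
  have tLi := memL _ (mem_nth n.*2.+1 sL).
  have leb : nth n.*2.+1 L i <= b0.
    have [//|lt] := attach_box_max tLi.
    by have := ltn_trans (ltn_trans u12 lt) h1; rewrite ltnn.
  move: leb; rewrite leq_eqVlt => /predU1P[//|lt].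
  pose j := index b0 L; have jL : j < size L by rewrite index_mem.
  have jE : nth n.*2.+1 L j = b0 by rewrite nth_index.
  have ij : i < j.
    rewrite ltnNge; apply/negP => ji; move: lt; rewrite -jE ltnNge => /negP; apply.
    apply: (sorted_leq_nth leq_trans leqnn) => //.
    by apply: sub_sorted Lsort => x y; apply: ltnW.
  have : nth n.*2.+1 L i.+1 <= b0.
    rewrite -jE; apply: (sorted_leq_nth leq_trans leqnn) => //.
      by apply: sub_sorted Lsort => x y; apply: ltnW.
    by rewrite inE; apply: leq_ltn_trans jL.
  by move/leq_ltn_trans/(_ bu); rewrite ltnNge ltnW.
rewrite E (leq_trans bu ub) /=; apply: leq_ltn_trans bu2 _.
(* After the last slot, nth returns the next record, which is beyond u. *)
have [i1|i1] := ltnP i.+1 (size L); last by rewrite nth_default // ltnS.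
have [le|//] := attach_box_max (memL _ (mem_nth n.*2.+1 i1)).
by have := sorted_ltn_nth ltn_trans n.*2.+1 Lsort i i.+1 sL i1 (ltnSn i); rewrite E ltnNge le.
Qed.

End Attachment.

Lemma diagrams_eq : HT_diagram n eta = tree_diagram n eta.
Proof.
have sz c : soliton_size (soliton_of c) = bsize c by rewrite /soliton_size size_map.
have -> : HT_diagram n eta = [seq [seq HT_entry n eta k i
    | i <- iota 0 (size (HT_slots n eta k))] | k <- iota 1 (max_branch n eta)].
  congr map; congr iota; rewrite /HT_max (perm_big _ HT_solitons_perm) big_map.
  by apply: eq_bigr => c _.
apply/eq_in_map => k; rewrite mem_iota => /andP[k0 _].
rewrite -tree_slots_boxes // size_map; apply/eq_in_map => i; rewrite mem_iota => /= lti.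
rewrite /HT_entry (permP HT_solitons_perm) count_map; apply: eq_in_count => c cl /=.
by rewrite sz; case: eqP => //= ck; apply: attachedE.
Qed.

End Forest.

Theorem proposition5 (n : nat) (e : seq nat) (he : soft_excursion n e) :
  x_diamond n e = x_star n e.
Proof. exact: diagrams_eq (matching_noncrossing he). Qed.
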